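(* Let $W$ be one of $W_H$, $W_L$, $W_J$, and let $\rho(x)=1$, $x$, or $1-x^2$ respectively. If $\mathcal A\in\mathcal D(W)$ is a differential operator of order $2m$, then its leading coefficient is of the form $c\,\rho(x)^mI$ for some $c\in\mathbb C$.
   Context: For a weight matrix $W$ with monic orthogonal polynomials $P_n$ (w.r.t. $\langle P,Q\rangle=\int PWQ^*dx$), $\mathcal D(W)$ is the algebra of differential operators $D=\sum_j\partial^jF_j$ with matrix polynomial coefficients, acting on the right by $P\cdot D=\sum_j\partial^j(P)F_j$, such that $P_n\cdot D=\Lambda_n(D)P_n$ for all $n\ge0$ with constant matrices $\Lambda_n(D)$; the leading coefficient of an operator of order $k$ is $F_k$. Classical scalar weights: Hermite $w_b(x)=e^{-x^2+2bx}$ on $\mathbb R$; Laguerre $w_\alpha(x)=e^{-x}x^\alpha$ on $(0,\infty)$, $\alpha>-1$; Jacobi $w_{\alpha,\beta}(x)=(1-x)^\alpha(1+x)^\beta$ on $(-1,1)$, $\alpha,\beta>-1$. Let $N\ge2$, $A=\sum_{j=1}^{\lfloor N/2\rfloor}a_{2j-1}E_{2j-1,2j}+\sum_{j=1}^{\lfloor (N-1)/2\rfloor}a_{2j}E_{2j+1,2j}$ ($E_{s,t}$ matrix units, all $a_j\in\mathbb R\setminus\{0\}$), $T(x)=I+Ax$. $W_H=T\,\mathrm{diag}(w_{b_1},\dots,w_{b_N})\,T^*$ with $b_i$ pairwise distinct reals; $W_L=T\,\mathrm{diag}(w_{\alpha_1},\dots,w_{\alpha_N})\,T^*$ with $\alpha_i-\alpha_j\notin\mathbb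 Z$ for $i\ne j$; $W_J=T\,\mathrm{diag}(w_{\alpha_1,\beta_1},\dots,w_{\alpha_N,\beta_N})\,T^*$ with, for $i\ne j$, $\alpha_i-\alpha_j\notin\mathbb Z$ or $\beta_i-\beta_j\notin\mathbb Z$, and $\alpha_1+\beta_1=\alpha_j+\beta_j+1+(-1)^j$ for all $j$. *)

(* Defs.v *)
From HB Require Import structures.
From mathcomp Require Import all_boot all_order all_algebra.
From mathcomp Require Import all_classical all_reals all_analysis.
From mathcomp Require Import complex.
Set Implicit Arguments. Unset Strict Implicit. Unset Printing Implicit Defensive.
Import Order.TTheory GRing.Theory Num.Theory.
Import numFieldNormedType.Exports.
Local Open Scope classical_set_scope.
Local Open Scope ring_scope.

Definition mxeval (K : nzRingType) (N : nat) (P : 'M[{poly K}]_N) (x : K)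
  : 'M[K]_N := map_mx (fun p => p.[x]) P.

Definition monic_mxpoly_deg (K : nzRingType) (N : nat) (n : nat)
  (P : 'M[{poly K}]_N) : Prop :=
  forall i j : 'I_N, (size (P i j) <= n.+1)%N /\ (P i j)`_n = (i == j)%:R.

(* The matrix inner product <P,Q> = \int_D P(x) W(x) Q(x)^* dx (real data,
   so Q^* = Q^T), computed entrywise with the Lebesgue integral over D. *)
Definition mx_ip (R : realType) (N : nat) (D : set R) (W : R -> 'M[R]_N)
  (P Q : 'M[{poly R}]_N) : 'M[R]_N :=
  \matrix_(i, j)
    (\int[lebesgue_measure]_(x in D)
        ((mxeval P x *m W x *m (mxeval Q x)^T) i j))%R.

Definition monic_OP_seq (R : realType) (N : nat) (D : set R) (W : R -> 'M[R]_N)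
  (PP : nat -> 'M[{poly R}]_N) : Prop :=
  (forall n, monic_mxpoly_deg n (PP n)) /\
  (forall n m, n <> m -> mx_ip D W (PP n) (PP m) = 0).

Definition cplx_mxpoly (R : rcfType) (N : nat) (P : 'M[{poly R}]_N)
  : 'M[{poly R[i]}]_N := map_mx (map_poly (fun r : R => (r%:C)%C)) P.

(* Right action of D = \sum_{j <= k} \partial^j F_j:
   P . D = \sum_{j <= k} \partial^j(P) F_j *)
Definition op_act (K : nzRingType) (N : nat) (k : nat)
  (F : nat -> 'M[{poly K}]_N) (P : 'M[{poly K}]_N) : 'M[{poly K}]_N :=
  \sum_(j < k.+1) (map_mx (fun p => p^`(j)) P *m F j).

Definition in_DW (R : realType) (N : nat) (D : set R) (W : R -> 'M[R]_N)
  (k : nat) (F : nat -> 'M[{poly R[i]}]_N) : Prop :=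
  forall PP : nat -> 'M[{poly R}]_N, monic_OP_seq D W PP ->
  forall n, exists Lam : 'M[R[i]]_N,
    op_act k F (cplx_mxpoly (PP n)) = map_mx polyC Lam *m cplx_mxpoly (PP n).

(* The matrix A: for 1 <= s <= N-1 (1-based), A_{s,s+1} = a_s if s is odd,
   A_{s+1,s} = a_s if s is even; all other entries 0.  Below with 0-based
   indices i, j. *)
Definition Amat (R : nzRingType) (N : nat) (a : nat -> R) : 'M[R]_N :=
  \matrix_(i < N, j < N)
    (if ((j : nat) == i.+1) && ~~ odd i then a i.+1
     else if ((i : nat) == j.+1) && odd j then a j.+1
     else 0).

Definition Tmat (R : nzRingType) (N : nat) (a : nat -> R) (x : R) : 'M[R]_N :=
  1%:M + x *: Amat N a.

(* W(x) = T(x) diag(w_1(x),...,w_N(x)) T(x)^*  (real, so ^* = ^T) *)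
Definition Wmat (R : nzRingType) (N : nat) (a : nat -> R) (w : 'I_N -> R -> R)
  (x : R) : 'M[R]_N :=
  Tmat N a x *m diag_mx (\row_i w i x) *m (Tmat N a x)^T.

Definition w_hermite (R : realType) (b : R) (x : R) : R := expR (- x ^+ 2 + 2 * b * x).
Definition w_laguerre (R : realType) (al : R) (x : R) : R := expR (- x) * x `^ al.
Definition w_jacobi (R : realType) (al be : R) (x : R) : R :=
  (1 - x) `^ al * (1 + x) `^ be.

Definition dom_hermite (R : realType) : set R := setT.
Definition dom_laguerre (R : realType) : set R := [set x | 0 < x].
Definition dom_jacobi (R : realType) : set R := [set x | -1 < x < 1].

Definition not_int (R : nzRingType) (r : R) : Prop := forall z : int, r <> z%:~R.

Definition leading_coef_form (R : rcfType) (N : nat) (F : nat -> 'M[{poly R[i]}]_N)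
  (m : nat) (rho : {poly R[i]}) : Prop :=
  exists c : R[i], F (2 * m)%N = (c *: rho ^+ m)%:M.

(* Main.v *)
(** Conjugating by [T = 1 + x A] turns the operator into a matrix of scalar differential operators
    acting on rows of polynomials orthogonal for the diagonal weight, and the adjoint that it has for
    the matrix inner product becomes an adjoint entry by entry. An off-diagonal entry would intertwine
    the functionals of two weights; the Pearson equations make this a Wronskian-type equation whose
    only solutions vanish, by the hypotheses on the parameters. So the conjugated operator is
    diagonal, and each diagonal entry has an adjoint and preserves degrees, hence is a polynomial in
    the second-order operator [rho f'' + tau f'] (Hermite, Laguerre) or commutes with it (Jacobi); in
    both cases its leading coefficient is [c rho ^ m], and [c] can be read off its eigenvalues.
    Since the operator before conjugation preserves degrees as well, the eigenvalues of neighbouring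
    entries agree up to a shift of the degree, and all the constants [c] coincide. Real and imaginary
    parts are treated separately. *)

Require Import Defs.
From HB Require Import structures.
From mathcomp Require Import all_boot all_order all_algebra.
From mathcomp Require Import all_classical all_reals all_analysis.
From mathcomp Require Import measurable_realfun complex.
From mathcomp Require Import ring lra zify.
Set Implicit Arguments. Unset Strict Implicit. Unset Printing Implicit Defensive.
Import Order.TTheory GRing.Theory Num.Theory.
Local Open Scope ring_scope.

(** Membership in [in_DW] is only an eigenvalue equation for the monic orthogonal polynomials. The
    adjoint has to be built from it, by Riesz representation on rows of bounded degree, and an
    orthogonal sequence has to be constructed, since without one the hypothesis would say nothing.
    Of the integrals, the algebra keeps a positive functional and a weak Pearson equation. The
    obstacle after conjugation is that [T] multiplies by [x], so degree bounds are lost; they come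
    back on the diagonal because [A] squares to zero. The two treatments of the diagonal entries
    differ for this reason: commuting with the second-order operator gives the shape [c rho ^ m],
    but the eigenvalue polynomial of an operator of order [2m] sees only the coefficient of
    [x ^ (2m)], which is [c] up to sign for [1 - x^2] and is zero for [1] and [x] once [m > 0]. In
    those two cases the eigenvalues of the second-order operator are proportional to [n], and a
    representation as a polynomial in it of degree at most [m] ties [c] to the coefficient of
    [n ^ m] instead. *)

Inductive in_span (K : nzRingType) (V : lmodType K) (s : seq V) : V -> Prop :=
| in_span0 : in_span s 0
| in_span_lin a v w of in_span s v & in_span s w : in_span s (a *: v + w)
| in_span_mem v of v \in s : in_span s v.

(** * Finite spans inside spaces of infinite dimension *)

Section Span.
Context {K : nzRingType} {V : lmodType K}.
Implicit Types (s : seq V) (v : V).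

Lemma in_spanD s v w : in_span s v -> in_span s w -> in_span s (v + w).
Proof. by move=> hv hw; rewrite -[v]scale1r; apply: in_span_lin. Qed.

Lemma in_spanZ s a v : in_span s v -> in_span s (a *: v).
Proof. by move=> hv; rewrite -[_ *: _]addr0; apply: in_span_lin => //; apply: in_span0. Qed.

Lemma in_spanB s v w : in_span s v -> in_span s w -> in_span s (v - w).
Proof. by move=> hv hw; rewrite -scaleN1r addrC; apply: in_span_lin. Qed.

Lemma in_span_sum (I : Type) (r : seq I) (P : pred I) (F : I -> V) s :
  (forall i, P i -> in_span s (F i)) -> in_span s (\sum_(i <- r | P i) F i).
Proof.
by move=> h; apply: (big_ind (in_span s)) => //; [apply: in_span0|move=> x y; apply: in_spanD].
Qed.

Lemma in_span_sub s t v : (forall x, x \in s -> in_span t x) -> in_span s v -> in_span t v.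
Proof.
move=> st; elim=> [|a x y _ hx _ hy|x /st //]; first exact: in_span0.
exact: in_span_lin.
Qed.

End Span.

(** * Riesz representation on a finite span *)

Section Riesz.
Context {R : realFieldType} {V : lmodType R}.
Variable B : V -> V -> R.
Hypothesis Bl : forall a x y z, B (a *: x + y) z = a * B x z + B y z.
Hypothesis BC : forall x y, B x y = B y x.
Hypothesis Bpos : forall x, x != 0 -> 0 < B x x.

Lemma form_linr a x y z : B z (a *: x + y) = a * B z x + B z y.
Proof. by rewrite BC Bl !(BC z). Qed.


Lemma span_eq_lin (phi psi : V -> R) (s : seq V) v :
  (forall a x y, phi (a *: x + y) = a * phi x + phi y) ->
  (forall a x y, psi (a *: x + y) = a * psi x + psi y) ->
  (forall x, x \in s -> phi x = psi x) -> in_span s v -> phi v = psi v.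
Proof.
move=> hphi hpsi h; elim=> [|a x y _ hx _ hy|//]; last by rewrite hphi hpsi hx hy.
have z (f : V -> R) : (forall a x y, f (a *: x + y) = a * f x + f y) -> f 0 = 0.
  by move=> hf; have := hf (-1) 0 0; rewrite scaler0 addr0 mulN1r addNr.
by rewrite !z.
Qed.

(** Gram-Schmidt, one vector at a time. The induction hypothesis for the functional [B^~ v] supplies
    the projection [p] of [v] on the span of [s]; the remainder [v - p] is orthogonal to that span,
    so adding a multiple of it to [w] adjusts the value at [v] and disturbs nothing else. *)
Lemma riesz_span (s : seq V) (phi : V -> R) :
  (forall a x y, phi (a *: x + y) = a * phi x + phi y) ->
  exists2 w, in_span s w & forall v, in_span s v -> B v w = phi v.
Proof.
have step t (f : V -> R) w : (forall a x y, f (a *: x + y) = a * f x + f y) ->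
    (forall v, v \in t -> B v w = f v) -> forall v, in_span t v -> B v w = f v.
  by move=> hf h v; apply: (@span_eq_lin (B^~ w)) => // a x y; rewrite Bl.
elim: s phi => [|v s IH] phi hphi.
  by exists 0; [exact: in_span0|by apply: (step [::] phi 0 hphi)].
have up x : in_span s x -> in_span (v :: s) x.
  by apply: in_span_sub => y ys; apply: in_span_mem; rewrite inE ys orbT.
have [p ps hp] := IH (B^~ v) (fun a x y => Bl a x y v).
have [w ws hw] := IH phi hphi.
have [e0|e0] := eqVneq (v - p) 0.
  exists w; first exact: up.
  apply: (step _ phi w hphi) => x; rewrite inE => /orP[/eqP->|xs]; last by apply/hw/in_span_mem.
  by move/eqP: e0; rewrite subr_eq0 => /eqP->; apply: hw.
set e := v - p in e0.
have es x : in_span s x -> B x e = 0.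
  by move=> xs; rewrite /e addrC -scaleN1r form_linr mulN1r hp // addNr.
have ve : v = 1 *: e + p by rewrite scale1r subrK.
have Bve : B v e = B e e by rewrite {1}ve Bl mul1r (es p ps) addr0.
exists (((phi v - B v w) / B e e) *: e + w).
  apply: in_span_lin; last exact: up.
  by apply: in_spanB; [apply: in_span_mem; rewrite mem_head|apply: up].
apply: (step _ phi _ hphi) => x; rewrite inE form_linr => /orP[/eqP->|xs].
  by rewrite Bve divfK ?subrK // gt_eqF // Bpos.
by have xs' := in_span_mem xs; rewrite (es x xs') mulr0 add0r hw.
Qed.

End Riesz.


(** * Positive functionals and operators with a degree-preserving adjoint *)

Section Functional.
Context {R : realFieldType}.
Implicit Types (u : {poly R} -> R) (f g q : {poly R}) (X Y : {poly R} -> {poly R}).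

Definition lin X := forall a f g, X (a *: f + g) = a *: X f + X g.

Definition posfun u :=
  (forall a f g, u (a *: f + g) = a * u f + u g) /\ (forall f, f != 0 -> 0 < u (f * f)).

Lemma posfun0 u : posfun u -> u 0 = 0.
Proof. by case=> ul _; have := ul (-1) 0 0; rewrite scaler0 addr0 mulN1r addNr. Qed.

Lemma posfunD u f g : posfun u -> u (f + g) = u f + u g.
Proof. by case=> ul _; have := ul 1 f g; rewrite scale1r mul1r. Qed.

Lemma posfunZ u a f : posfun u -> u (a *: f) = a * u f.
Proof. by move=> up; case: (up) => ul _; have := ul a f 0; rewrite addr0 posfun0 // addr0. Qed.

Lemma posfunB u f g : posfun u -> u (f - g) = u f - u g.
Proof. by move=> up; rewrite posfunD // -scaleN1r posfunZ // mulN1r. Qed.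

Lemma posfun_faithful u f : posfun u -> (forall g, u (g * f) = 0) -> f = 0.
Proof.
move=> [_ up] h; have [//|/up] := eqVneq f 0.
by rewrite h ltxx.
Qed.

Lemma lin0 X : lin X -> X 0 = 0.
Proof. by move=> Xl; have := Xl (-1) 0 0; rewrite scaler0 addr0 scaleN1r addNr. Qed.
Lemma linZ X a f : lin X -> X (a *: f) = a *: X f.
Proof. by move=> Xl; have := Xl a f 0; rewrite addr0 lin0 // addr0. Qed.
Lemma linD X f g : lin X -> X (f + g) = X f + X g.
Proof. by move=> Xl; have := Xl 1 f g; rewrite !scale1r. Qed.
Lemma linB X f g : lin X -> X (f - g) = X f - X g.
Proof. by move=> Xl; rewrite linD // -scaleN1r linZ // scaleN1r. Qed.
Definition monomials n : seq {poly R} := [seq 'X^k | k <- iota 0 n].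

Lemma span_monomials n f : (size f <= n)%N -> in_span (monomials n) f.
Proof.
move=> sf; rewrite -[f]coefK poly_def; apply: in_span_sum => i _.
apply/in_spanZ/in_span_mem/mapP; exists (i : nat) => //.
by rewrite mem_iota /= add0n (leq_trans (ltn_ord i)).
Qed.

Lemma size_span_monomials n f : in_span (monomials n) f -> (size f <= n)%N.
Proof.
elim=> [|a v w _ hv _ hw|v /mapP[k]]; first by rewrite size_poly0.
  apply: leq_trans (size_polyD _ _) _; rewrite geq_max hw andbT.
  exact: leq_trans (size_scale_leq _ _) hv.
by rewrite mem_iota /= add0n => kn ->; rewrite size_polyXn.
Qed.

Lemma riesz_poly u n (phi : {poly R} -> R) : posfun u ->
  (forall a x y, phi (a *: x + y) = a * phi x + phi y) ->
  exists2 p : {poly R}, (size p <= n)%N & forall f, (size f <= n)%N -> u (f * p) = phi f.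
Proof.
move=> up phil; case: (up) => ul upp.
have Bl a (x y z : {poly R}) : u ((a *: x + y) * z) = a * u (x * z) + u (y * z).
  by rewrite mulrDl -scalerAl ul.
have BC (x y : {poly R}) : u (x * y) = u (y * x) by rewrite mulrC.
have [p ps hp] := @riesz_span R {poly R} (fun f g => u (f * g)) Bl BC upp (monomials n) phi phil.
by exists p => [|f /span_monomials]; [apply: size_span_monomials|apply: hp].
Qed.

Definition degpres X := forall n f, (size f <= n)%N -> (size (X f) <= n)%N.

(** The same [n] bounds [g] and [y]: the adjoint must preserve degrees too, which is what makes a
    degree-lowering operator of this kind vanish. *)
Definition adjointable u X := degpres X /\
  forall n g, (size g <= n)%N ->
    exists2 y : {poly R}, (size y <= n)%N & forall f, u (X f * g) = u (f * y).

Lemma adjointable_id u : adjointable u id.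
Proof. by split=> // n g sg; exists g. Qed.

Lemma adjointable_comp u X Y : adjointable u X -> adjointable u Y -> adjointable u (X \o Y).
Proof.
move=> [dX aX] [dY aY]; split=> [n f sf|n g sg]; first by apply/dX/dY.
have [y sy hy] := aX n g sg; have [z sz hz] := aY n y sy.
by exists z => // f; rewrite /= hy hz.
Qed.

Lemma adjointable_lin u a X Y : posfun u -> adjointable u X -> adjointable u Y ->
  adjointable u (fun f => a *: X f + Y f).
Proof.
move=> up [dX aX] [dY aY]; split=> [n f sf|n g sg].
  apply: leq_trans (size_polyD _ _) _; rewrite geq_max dY // andbT.
  by apply: leq_trans (size_scale_leq _ _) _; apply: dX.
have [y sy hy] := aX n g sg; have [z sz hz] := aY n g sg.
exists (a *: y + z).
  apply: leq_trans (size_polyD _ _) _; rewrite geq_max sz andbT.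
  exact: leq_trans (size_scale_leq _ _) _.
move=> f; rewrite mulrDl mulrDr -scalerAl -scalerAr !posfunD // !posfunZ //.
by rewrite hy hz.
Qed.

(* Correcting [f] by a polynomial of lower degree, on which [Z] already vanishes, makes it
   orthogonal to everything of lower degree; then [u (Z f * Z f) = u (f * y) = 0]. *)
Lemma lowering_adjointable0 u Z : posfun u -> lin Z -> adjointable u Z ->
  (forall n f, (size f <= n.+1)%N -> (size (Z f) <= n)%N) -> forall f, Z f = 0.
Proof.
move=> up Zl [_ aZ] low f; have [n] := ubnP (size f); elim: n f => // n IH f.
rewrite ltnS => sf; case: n => [|n] in IH sf *.
  by move: sf; rewrite leqn0 size_poly_eq0 => /eqP->; rewrite lin0.
have phil a x y : u ((a *: x + y) * f) = a * u (x * f) + u (y * f).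
  by rewrite mulrDl -scalerAl up.1.
have [p sp hp] := @riesz_poly u n (fun g => u (g * f)) up phil.
have Zfp : Z (f - p) = Z f by rewrite linB // (IH p) ?subr0 // ltnS.
have [y sy hy] := aZ n (Z f) (low _ _ sf).
have [//|/(proj2 up)] := eqVneq (Z f) 0.
by rewrite -{1}Zfp hy mulrC mulrBr posfunB // hp // subrr ltxx.
Qed.

Definition polyop (q : {poly R}) X f := \sum_(i < size q) q`_i *: iter i X f.

Lemma lin_iter X i : lin X -> lin (iter i X).
Proof. by move=> Xl; elim: i => // i IH a f g /=; rewrite IH Xl. Qed.

Lemma lin_polyop q X : lin X -> lin (polyop q X).
Proof.
move=> Xl a f g; rewrite /polyop scaler_sumr -big_split /=; apply: eq_bigr => i _.
by rewrite lin_iter // scalerDr !scalerA mulrC.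
Qed.

Lemma adjointable_iter u X i : adjointable u X -> adjointable u (iter i X).
Proof.
move=> aX; elim: i => [|i IH]; first exact: adjointable_id.
exact: (adjointable_comp aX IH).
Qed.

Lemma adjointable_polyop u q X : posfun u -> adjointable u X -> adjointable u (polyop q X).
Proof.
move=> up aX; rewrite /polyop; elim: (size q) => [|n IH].
  split=> [n f _|n g _]; first by rewrite big_ord0 size_poly0.
  by exists 0 => [|f]; rewrite ?size_poly0 // big_ord0 mul0r mulr0.
have aXn := adjointable_iter n aX.
have [dY aY] := adjointable_lin q`_n up aXn IH.
split=> [m f /dY|m g /aY[y sy hy]]; first by rewrite big_ord_recr addrC.
by exists y => // f; rewrite big_ord_recr /= addrC hy.
Qed.

End Functional.


(** * Scalar differential operators: coefficients, eigenvalues, Pearson equation *)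

Section ScalarOperators.
Context {R : realFieldType}.
Implicit Types (u : {poly R} -> R) (f g p q r rho tau : {poly R}) (X Y : {poly R} -> {poly R}).
Implicit Types (e : nat -> {poly R}).

Lemma poly_neq0_nat p : p != 0 -> exists n : nat, p.[n%:R] != 0.
Proof.
move=> p0; suff /allPn[_ /mapP[n _ ->] pa] : ~~ all (root p) [seq n%:R | n <- iota 0 (size p)].
  by exists n.
apply/negP => /(max_poly_roots p0); rewrite size_map size_iota ltnn => /(_ _)/notF; apply.
by rewrite map_inj_uniq ?iota_uniq // => i j /eqP; rewrite eqr_nat => /eqP.
Qed.

Lemma poly_neq0_eval p : p != 0 -> exists a, p.[a] != 0.
Proof. by move=> /poly_neq0_nat[n pn]; exists n%:R. Qed.

Lemma poly_eval_inj p q : (forall a, p.[a] = q.[a]) -> p = q.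
Proof.
move=> h; apply/eqP; rewrite -subr_eq0; apply/negPn/negP => /poly_neq0_eval[a].
by rewrite hornerD hornerN h subrr eqxx.
Qed.

Lemma deriv_shift p (a : R) : (p \Po ('X + a%:P))^`() = p^`() \Po ('X + a%:P).
Proof. by rewrite deriv_comp derivD derivX derivC addr0 mulr1. Qed.

Lemma derivn_shift p (a : R) l : (p \Po ('X + a%:P))^`(l) = p^`(l) \Po ('X + a%:P).
Proof. by elim: l => // l IH; rewrite !derivnS IH deriv_shift. Qed.

Lemma horner_shift0 p (a : R) : (p \Po ('X + a%:P))`_0 = p.[a].
Proof. by rewrite -horner_coef0 horner_comp !hornerE. Qed.

Lemma horner_derivn p l (a : R) : p^`(l).[a] = (p \Po ('X + a%:P))`_l *+ l`!.
Proof. by rewrite -horner_shift0 -derivn_shift coef_derivn addn0 ffactnn. Qed.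

Lemma coef1_shift p (a : R) : (p \Po ('X + a%:P))`_1 = p^`().[a].
Proof. by have := horner_derivn p 1 a; rewrite mulr1n derivn1. Qed.

Lemma shift_XsubC (a : R) k : ('X - a%:P) ^+ k \Po ('X + a%:P) = 'X^k.
Proof. by rewrite rmorphXn /= comp_polyB comp_polyX comp_polyC addrK. Qed.

Definition dop d e f := \sum_(l < d.+1) f^`(l) * e l.

Lemma lin_dop d e : lin (dop d e).
Proof.
move=> a f g; rewrite /dop scaler_sumr -big_split /=; apply: eq_bigr => l _.
by rewrite derivnD derivnZ mulrDl scalerAl.
Qed.

(** At [a], the derivatives of [('X - a) ^ k] of every order other than [k] vanish, so this test
    polynomial isolates one coefficient of the operator. *)
Lemma horner_dop_XsubC d e (a : R) k :
  (dop d e (('X - a%:P) ^+ k)).[a] = if (k <= d)%N then (e k).[a] *+ k`! else 0.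
Proof.
rewrite /dop horner_sum.
have t (l : nat) : (((('X - a%:P) ^+ k)^`(l)) * e l).[a] =
    if k == l then (e k).[a] *+ k`! else 0.
  rewrite hornerM horner_derivn shift_XsubC coefXn eq_sym.
  by case: eqP => [->|_]; rewrite ?mul0rn ?mul0r // mulrnAl mul1r.
case: leqP => kd.
  rewrite (bigD1 (Ordinal (kd : (k < d.+1)%N))) //= t eqxx big1 ?addr0 // => i.
  by rewrite t -val_eqE /= eq_sym => /negPf->.
by rewrite big1 // => i _; rewrite t gtn_eqF // (leq_trans (ltn_ord i)).
Qed.

(** The falling factorial [x (x - 1) ... (x - l + 1)], the factor produced by [l] derivatives of
    [x ^ n] when [x = n]. *)
Definition ffpoly l : {poly R} := \prod_(i < l) ('X - i%:R%:P).

Lemma size_ffpoly l : size (ffpoly l) = l.+1.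
Proof.
rewrite /ffpoly (size_prod_XsubC _ (fun i : 'I_l => i%:R)).
by rewrite [index_enum _]unlock -enumT size_enum_ord.
Qed.

Lemma ffpoly_coef l : (ffpoly l)`_l = 1.
Proof.
have /monicP := monic_prod_XsubC (index_enum 'I_l) predT (fun i : 'I_l => (i%:R : R)).
by rewrite lead_coefE -/(ffpoly l) size_ffpoly.
Qed.

Lemma horner_ffpoly l n : (ffpoly l).[n%:R] = (n ^_ l)%:R.
Proof.
elim: l => [|l IH]; first by rewrite /ffpoly big_ord0 hornerE ffactn0.
rewrite /ffpoly big_ord_recr /= hornerM -/(ffpoly l) IH ffactnSr natrM.
case: (leqP l n) => ln; first by rewrite natrB // !hornerE.
by rewrite ffact_small // !mul0r.
Qed.

(** The derivative of order [l] of ['X^n] has degree [n - l], so only coefficient [l] of [e l] lifts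
    it back to degree [n]. The eigenvalues of a degree-preserving operator are therefore polynomial
    in [n]. *)
Lemma dop_eigenvalue d e n :
  (dop d e 'X^n)`_n = (\sum_(l < d.+1) (e l)`_l *: ffpoly l).[n%:R].
Proof.
rewrite /dop coef_sum horner_sum; apply: eq_bigr => l _.
rewrite hornerZ horner_ffpoly derivnXn mulrnAl coefMn coefXnM.
case: (leqP l n) => ln; last by rewrite ffact_small // mulr0n mulr0.
by rewrite ltnNge leq_subr /= subKn // mulr_natr.
Qed.

Lemma size_eigenvalue_poly d e : (size (\sum_(l < d.+1) (e l)`_l *: ffpoly l)%R <= d.+1)%N.
Proof.
apply: leq_trans (size_sum _ _ _) _; apply/bigmax_leqP => i _.
by apply: leq_trans (size_scale_leq _ _) _; rewrite size_ffpoly.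
Qed.

Lemma coef_eigenvalue_poly d e : (\sum_(l < d.+1) (e l)`_l *: ffpoly l)`_d = (e d)`_d.
Proof.
rewrite coef_sum big_ord_recr /= coefZ ffpoly_coef mulr1 big1 ?add0r // => i _.
by rewrite coefZ [(ffpoly _)`_d]nth_default ?mulr0 // size_ffpoly.
Qed.

Lemma size_leq_coef0 p n : (size p <= n.+1)%N -> p`_n = 0 -> (size p <= n)%N.
Proof.
move=> sp pn; apply/leq_sizeP => j; rewrite leq_eqVlt => /orP[/eqP<-//|nj].
by rewrite nth_default // (leq_trans sp).
Qed.

(** Degree-preserving operators are triangular on monomials, so their diagonal coefficients multiply
    under composition. *)
Lemma degpres_coef X n f : lin X -> degpres X -> (size f <= n.+1)%N ->
  (X f)`_n = f`_n * (X 'X^n)`_n.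
Proof.
move=> Xl dX sf; have -> : f = f`_n *: 'X^n + (f - f`_n *: 'X^n) by rewrite addrC subrK.
set g := f - _; have sg : (size g <= n)%N.
  apply: size_leq_coef0; last by rewrite coefB coefZ coefXn eqxx mulr1 subrr.
  apply: leq_trans (size_polyD _ _) _; rewrite geq_max sf size_polyN.
  by apply: leq_trans (size_scale_leq _ _) _; rewrite size_polyXn.
rewrite Xl coefD coefZ [(X g)`_n]nth_default ?dX // addr0.
by rewrite coefD coefZ coefXn eqxx mulr1 [g`_n]nth_default // addr0.
Qed.

Definition delta rho tau f := rho * f^`(2) + tau * f^`().

(** The weak form of [(rho w)' = tau w], with vanishing boundary terms of [rho w h]. *)
Definition pearson u rho tau := forall h, u (tau * h + rho * h^`()) = 0.

Lemma lin_delta rho tau : lin (delta rho tau).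
Proof.
move=> a f g; rewrite /delta derivnD derivnZ derivD derivZ.
by rewrite !mulrDr -!scalerAr scalerDr addrACA.
Qed.

Lemma size_derivn_leq f l : f^`(l) != 0 -> (size f^`(l) + l <= size f)%N.
Proof.
elim: l => [|l IH]; first by rewrite addn0.
rewrite derivnS => h; have h0 : f^`(l) != 0 by apply: contraNneq h => ->; rewrite deriv0.
by rewrite addnS -addSn; apply: leq_trans (IH h0); rewrite leq_add2r lt_size_deriv.
Qed.

Lemma size_mul_derivn p f l : (size p <= l.+1)%N -> (size (p * f^`(l))%R <= size f)%N.
Proof.
move=> sp; have [->|h] := eqVneq f^`(l) 0; first by rewrite mulr0 size_poly0.
apply: leq_trans (size_polyMleq _ _) _; apply: leq_trans (size_derivn_leq h).
by move: sp; lia.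
Qed.

Lemma degpres_delta rho tau : (size rho <= 3)%N -> (size tau <= 2)%N -> degpres (delta rho tau).
Proof.
move=> sr st n f sf; rewrite /delta -derivn1.
apply: leq_trans (size_polyD _ _) _; rewrite geq_max.
by rewrite !(leq_trans (size_mul_derivn _ _)).
Qed.

Lemma delta_eigenvalue rho tau n :
  (delta rho tau 'X^n)`_n = rho`_2 * (n * n.-1)%:R + tau`_1 * n%:R.
Proof.
rewrite /delta coefD -derivn1 !derivnXn !mulrnAr !coefMn !coefMXn ffactnS ffactn1.
case: n => [|[|n]].
- by rewrite !mul0n !mulr0n.
- by rewrite /= muln0 !mulr0n mulr1.
have -> : (n.+2 < n.+2 - 2)%N = false by lia.
have -> : (n.+2 < n.+2 - 1)%N = false by lia.
have -> : (n.+2 - (n.+2 - 2) = 2)%N by lia.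
have -> : (n.+2 - (n.+2 - 1) = 1)%N by lia.
by rewrite !mulr1 ?ffactn1.
Qed.

Lemma adjointable_delta u rho tau : posfun u -> pearson u rho tau ->
  (size rho <= 3)%N -> (size tau <= 2)%N -> adjointable u (delta rho tau).
Proof.
move=> up pe sr st; split; first exact: degpres_delta.
move=> n g sg; exists (delta rho tau g); first exact: degpres_delta.
(* Integration by parts turns [u (delta p * q)] into a Dirichlet form symmetric in [p] and [q];
   hence [delta] is its own adjoint. *)
have half p q : u (delta rho tau p * q) = - u (rho * p^`() * q^`()).
  apply/eqP; rewrite -subr_eq0 opprK -posfunD //; apply/eqP.
  rewrite -[RHS](pe (p^`() * q)); congr (u _).
  by rewrite /delta derivnS derivn1 derivM; ring.
move=> f; rewrite half [f * _]mulrC half; congr (- u _); ring.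
Qed.

End ScalarOperators.


(** * Commutation with the second-order operator *)

Section ScalarSymbols.
Context {R : realFieldType}.
Variables (u : {poly R} -> R) (rho tau : {poly R}).
Hypotheses (up : posfun u) (pe : pearson u rho tau).
Hypotheses (srho : (size rho <= 3)%N) (stau : (size tau <= 2)%N).
Let D := delta rho tau.
Let Dl : lin D := lin_delta rho tau.
Let Da : adjointable u D := adjointable_delta up pe srho stau.

(** The diagonal coefficients of two triangular operators are scalars and commute, so the commutator
    lowers degrees; it also has an adjoint, and so is zero. *)
Lemma delta_comm X : lin X -> adjointable u X -> forall f, X (D f) = D (X f).
Proof.
move=> Xl Xa f; pose Z f := (-1) *: D (X f) + X (D f).
suff : Z f = 0 by rewrite /Z scaleN1r addrC => /eqP; rewrite subr_eq0 => /eqP.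
have ZL : lin Z.
  move=> a g h; rewrite /Z !(Xl, Dl) -!mul_polyC; ring.
have Za : adjointable u Z.
  exact: (adjointable_lin (-1) up (adjointable_comp Da Xa) (adjointable_comp Xa Da)).
apply: (lowering_adjointable0 up ZL Za) => n g sg; apply: size_leq_coef0; first exact: Za.1.
have [dX _] := Xa; have [dD _] := Da.
rewrite /Z coefD coefZ (degpres_coef (f := X g) Dl) ?dX // (degpres_coef (f := g) Xl) //.
rewrite (degpres_coef (f := D g) Xl) ?dD // (degpres_coef (f := g) Dl) //; ring.
Qed.

(** This is the vanishing of the Poisson bracket of the principal symbols. Both compositions have
    order [d + 3] with the same top coefficient; the bracket sits one order lower, hence the test
    polynomial [('X - a) ^ (d + 2)]. The terms in [e d] and in [tau] cancel. *)
Lemma delta_comm_symbol d (e : nat -> {poly R}) :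
  (forall f, dop d.+1 e (D f) = D (dop d.+1 e f)) ->
  d.+1%:R *: (rho^`() * e d.+1) = 2 *: (rho * (e d.+1)^`()).
Proof.
move=> h; apply: poly_eval_inj => a; pose g := ('X - a%:P) ^+ d.+2.
pose s (p : {poly R}) := p \Po ('X + a%:P).
have sg l : s (g^`(l)) = 'X^(d.+2 - l) *+ d.+2 ^_ l.
  by rewrite /s -derivn_shift /g shift_XsubC derivnXn.
have sM p q : s (p * q) = s p * s q by rewrite /s comp_polyM.
have sD p q : s (p + q) = s p + s q by rewrite /s comp_polyD.
have f1 : (d.+2 ^_ d.+1 = (d.+2)`!)%N.
  by have := @ffact_fact d.+2 d.+1 (leqnSn _); rewrite subSnn muln1.
have f2 : (d.+2 ^_ d * 2 = (d.+2)`!)%N.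
  have := @ffact_fact d.+2 d (leq_trans (leqnSn _) (leqnSn _)).
  by have -> : (d.+2 - d = 2)%N by lia.
have L : (dop d.+1 e (D g)).[a] =
    (rho.[a] * (d.+2 * d.+1)%:R) * (e d).[a] * d`!%:R +
    (rho^`().[a] * (d.+2 * d.+1)%:R + tau.[a] * d.+2%:R) * (e d.+1).[a] * (d.+1)`!%:R.
  have c k : (s (D g))`_k = 
     (if (k < d)%N then 0 else (s rho)`_(k - d)) * (d.+2 * d.+1)%:R + 
     (if (k < d.+1)%N then 0 else (s tau)`_(k - d.+1)) * d.+2%:R.
    rewrite /D /delta sD !sM -derivn1 !sg !mulrnAr coefD !coefMn !coefMXn.
    by rewrite ffactnS !ffactn1 subSS subSS subn0 subn1 /= !mulr1.
  (* [D g] vanishes at [a] to order at least [d], so only the two highest derivatives contribute. *)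
  rewrite /dop horner_sum big_ord_recr big_ord_recr /= big1 ?add0r => [|i _].
    have -> : ((D g)^`(d) * e d).[a] = (s (D g))`_d *+ d`! * (e d).[a].
      by rewrite hornerM horner_derivn.
    have -> : ((D g)^`(d.+1) * e d.+1).[a] = (s (D g))`_d.+1 *+ (d.+1)`! * (e d.+1).[a].
      by rewrite hornerM horner_derivn.
    have sdd : (d.+1 < d)%N = false by lia.
    rewrite !c sdd ltnSn !ltnn !subnn subSnn /s !horner_shift0 coef1_shift.
    have nq (x y : R) n : x *+ n * y = x * y * n%:R by rewrite mulrnAl mulr_natr.
    by rewrite !nq mul0r addr0.
  rewrite hornerM horner_derivn -/(s _) c ltn_ord (ltn_trans (ltn_ord i)) //.
  by rewrite !mul0r addr0 mul0rn mul0r.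
have Rr : (D (dop d.+1 e g)).[a] =
    rho.[a] * 2 * ((d.+2)`!%:R * (e d.+1)^`().[a] + (d.+2 ^_ d)%:R * (e d).[a]) +
    tau.[a] * ((d.+2)`!%:R * (e d.+1).[a]).
  (* [D] has order two, so only Taylor coefficients of [dop d.+1 e g] up to degree two matter, and
     these involve only [e d] and [e d.+1]. *)
  have c k : (k <= 2)%N -> (s (dop d.+1 e g))`_k =
     (if (k < 2)%N then 0 else (s (e d))`_(k - 2) * (d.+2 ^_ d)%:R) + 
     (if (k < 1)%N then 0 else (s (e d.+1))`_(k - 1) * (d.+2 ^_ d.+1)%:R).
    move=> k2; have sS (F : nat -> {poly R}) : s (\sum_(l < d.+2) F l) = \sum_(l < d.+2) s (F l).
      by rewrite /s rmorph_sum.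
    rewrite /dop (sS (fun l => g^`(l) * e l)) coef_sum big_ord_recr big_ord_recr /= -derivnS big1 => [|i _].
      rewrite add0r -!/(s _) !sM !sg !mulrnAl !coefMn !coefXnM.
      have -> : (d.+2 - d = 2)%N by lia.
      have -> : (d.+2 - d.+1 = 1)%N by lia.
      by congr (_ + _); case: ltnP => // _; rewrite ?mul0rn // mulr_natr.
    rewrite -!/(s _) sM sg mulrnAl coefMn coefXnM.
    have -> : (k < d.+2 - i)%N by have := ltn_ord i; lia.
    by rewrite mul0rn.
  rewrite /D /delta hornerD !hornerM horner_derivn -derivn1 horner_derivn -/(s _) !c //=.
  rewrite f1 /s !horner_shift0 coef1_shift !add0r mulr1n -(mulr_natr _ 2`!).
  rewrite (_ : 2`! = 2%N) //; ring.
have d2 : ((d.+2)`! = d.+2 * d.+1 * d`!)%N by rewrite !factS mulnA.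
have d1 : ((d.+1)`! = d.+1 * d`!)%N by rewrite factS.
have := h g; move/(congr1 (fun p => p.[a])); rewrite L Rr.
have -> : rho.[a] * 2 * ((d.+2)`!%:R * (e d.+1)^`().[a] + (d.+2 ^_ d)%:R * (e d).[a]) =
  rho.[a] * (2 * (d.+2)`!%:R * (e d.+1)^`().[a] + (d.+2)`!%:R * (e d).[a]).
  by rewrite -f2 natrM; ring.
rewrite d2 d1 !natrM => E.
have k0 : d.+2%:R * d.+1%:R * d`!%:R != 0 :> R.
  by rewrite -!natrM pnatr_eq0 -lt0n !muln_gt0 fact_gt0.
apply: (mulfI k0); rewrite !hornerZ !hornerM; move: E.
move: (d.+2%:R) (d.+1%:R) (d`!%:R) => x1 x2 x3 E; lra.
Qed.

End ScalarSymbols.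


(** * The leading coefficient of a scalar operator with an adjoint *)

Section LeadingSymbol.
Context {R : realFieldType}.
Implicit Types (u : {poly R} -> R) (f g p q r rho tau : {poly R}) (e : nat -> {poly R}).

Lemma deriv_XsubC_exp (a : R) k h :
  (('X - a%:P) ^+ k.+1 * h)^`() = ('X - a%:P) ^+ k * (k.+1%:R%:P * h + ('X - a%:P) * h^`()).
Proof.
rewrite derivM deriv_exp derivXsubC mul1r /= -mulr_natr -polyC1 -polyCMn exprS; ring.
Qed.

(** Subtract the multiple of [r] that agrees with [p] at a point [a] where [r] is nonzero. The
    difference satisfies the same equation and vanishes at [a]; comparing lowest-order terms there
    rules out every finite order of vanishing. *)
Lemma proportional_of_wronskian0 p r : r != 0 -> p^`() * r = p * r^`() ->
  exists c : R, p = c *: r.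
Proof.
move=> r0 w; have [a ra] := poly_neq0_eval r0.
pose c := p.[a] / r.[a]; exists c; apply/eqP; rewrite -subr_eq0; apply/negPn/negP => g0.
have [k [h ha gE]] := multiplicity_XsubC (p - c *: r) a.
rewrite g0 /= in ha.
have wg : (p - c *: r)^`() * r = (p - c *: r) * r^`().
  by rewrite derivB derivZ !mulrBl w -!scalerAl [_ * r]mulrC.
have ga : (p - c *: r).[a] = 0 by rewrite !hornerE /c divfK ?subrr.
case: k gE => [|k] gE.
  by move: ga; rewrite gE expr0 mulr1 => /eqP; rewrite -rootE (negPf ha).
have X0 : ('X - a%:P) ^+ k != 0 by rewrite expf_neq0 // polyXsubC_eq0.
move: wg; rewrite gE [h * _]mulrC deriv_XsubC_exp exprSr -!mulrA => /(mulfI X0).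
move/(congr1 (fun p => p.[a])); rewrite !hornerE subrr !mul0r addr0 => /eqP.
rewrite /= !mul0r !mulf_eq0 (negPf ra) pnatr_eq0 /= orbF -rootE => ha'.
by rewrite ha' in ha.
Qed.

(** [p] and [rho ^+ m] solve the same first-order linear equation, so their Wronskian vanishes. *)
Lemma symbol_eq_scale_exp rho p m : rho != 0 ->
  rho * p^`() = m%:R *: (rho^`() * p) -> exists c : R, p = c *: rho ^+ m.
Proof.
move=> r0 h; apply: proportional_of_wronskian0; first exact: expf_neq0.
apply: (mulfI r0); rewrite deriv_exp mulrA h -mul_polyC.
have -> (x : {poly R}) : x *+ m = m%:R%:P * x by rewrite mul_polyC scaler_nat.
case: m h => [|m] h /=; first by rewrite !(mul0r, mulr0).
by rewrite exprS; ring.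
Qed.

(** The common outcome of both routes. [Q] interpolates the eigenvalues, and for nonzero [theta] the
    last clause recovers [c] from them, which allows the constants of different entries to be
    compared. *)
Definition symbol_spec theta k rho m (X : {poly R} -> {poly R}) e : Prop :=
  exists c : R, exists Q : {poly R},
    [/\ (size Q <= k.+1)%N, forall n, (X 'X^n)`_n = Q.[n%:R],
        e (2 * m)%N = c *: rho ^+ m & Q`_k = theta * c].

Section Weight.
Variables (u : {poly R} -> R) (rho tau : {poly R}).
Hypotheses (up : posfun u) (pe : pearson u rho tau).
Hypotheses (srho : (size rho <= 3)%N) (stau : (size tau <= 2)%N) (r0 : rho != 0).
Variables (m : nat) (e : nat -> {poly R}).
Hypothesis Xa : adjointable u (dop (2 * m) e).

Lemma coef_exp_quadratic n : (rho ^+ n)`_(2 * n) = rho`_2 ^+ n.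
Proof.
have sn k : (size (rho ^+ k) <= (2 * k).+1)%N.
  apply: leq_trans (size_poly_exp_leq _ _) _; rewrite ltnS leq_mul2r orbC.
  by move: srho; case: (size rho) => // s; rewrite ltnS => ->.
elim: n => [|n IH]; first by rewrite muln0 !expr0 coef1.
have -> : (2 * n.+1 = 2 + 2 * n)%N by lia.
rewrite !exprS coefM (bigD1 (inord 2)) //= inordK; last by lia.
rewrite addKn IH big1 ?addr0 // => i; rewrite -val_eqE /= inordK; last by lia.
move=> i2; have [ilt|ige] := ltnP i 2.
  by rewrite [(rho ^+ n)`_ _]nth_default ?mulr0 //; apply: leq_trans (sn n) _; lia.
by rewrite nth_default ?mul0r //; apply: leq_trans srho _; lia.
Qed.

Lemma symbol_spec_quadratic : symbol_spec (rho`_2 ^+ m) (2 * m) rho m (dop (2 * m) e) e.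
Proof.
have [c ec] : exists c : R, e (2 * m)%N = c *: rho ^+ m.
  have := delta_comm up pe srho stau (@lin_dop _ _ _) Xa.
  (* For [m = 0] the operator is multiplication by [e 0]; its value at [1] has degree zero, so [e 0]
     is constant. *)
  case: (m) Xa => [|k] Ya h.
    have := Ya.1 1%N 1; rewrite size_poly1 => /(_ isT); rewrite muln0 /dop big_ord1 mul1r => s1.
    by exists (e 0)`_0; rewrite expr0 [LHS]size1_polyC // alg_polyC.
  apply: symbol_eq_scale_exp => //.
  have e2 : (2 * k.+1 = (2 * k).+1.+1)%N by lia.
  have := @delta_comm_symbol _ rho tau srho stau (2 * k).+1 e.
  rewrite -e2 => /(_ h) E.
  apply: (@scalerI _ _ (2 : R)); first by rewrite pnatr_eq0.
  by rewrite -E scalerA -natrM.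
exists c, (\sum_(l < (2 * m).+1) (e l)`_l *: ffpoly l); split=> //.
- exact: size_eigenvalue_poly.
- exact: dop_eigenvalue.
- by rewrite coef_eigenvalue_poly ec coefZ coef_exp_quadratic mulrC.
Qed.

(** Each application of [delta] lowers the order of vanishing at [a] by at most two. The lowest term
    comes from [rho f''] alone, which yields a falling factorial and a power of [rho.[a]]. *)
Lemma iter_delta_XsubC (a : R) s t r : exists2 r', r'.[a] = ((2 * s + t) ^_ (2 * s))%:R * rho.[a] ^+ s * r.[a]
  & iter s (delta rho tau) (('X - a%:P) ^+ (2 * s + t) * r) = ('X - a%:P) ^+ t * r'.
Proof.
elim: s t => [|s IH] t; first by exists r; rewrite //= muln0 ffactn0 expr0 !mul1r.
have [r' r'a r'E] := IH t.+2.
have -> : (2 * s.+1 + t = 2 * s + t.+2)%N by lia.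
rewrite iterS r'E /delta derivnS derivn1 !deriv_XsubC_exp derivD !derivM derivC derivXsubC.
exists (rho * (t.+1%:R%:P * (t.+2%:R%:P * r' + ('X - a%:P) * r'^`()) + ('X - a%:P) *
    (0 * r' + t.+2%:R%:P * r'^`() + (1 * r'^`() + ('X - a%:P) * r'^`()^`()))) +
    tau * (('X - a%:P) * (t.+2%:R%:P * r' + ('X - a%:P) * r'^`()))).
  rewrite !hornerE !subrr !(mul0r, mulr0, addr0) r'a.
  have -> : (2 * s.+1 = (2 * s).+2)%N by lia.
  have -> : (2 * s + t.+2 = (2 * s + t).+2)%N by lia.
  rewrite [in RHS]ffactnSr [in RHS]ffactnSr.
  have -> : ((2 * s + t).+2 - (2 * s).+1 = t.+1)%N by lia.
  have -> : ((2 * s + t).+2 - (2 * s) = t.+2)%N by lia.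
  by rewrite !natrM exprS /=; ring.
by rewrite exprS; ring.
Qed.

(* The eigenvalues of [delta rho tau] are [kappa * n], so that [X] has the same eigenvalues as a
   polynomial [q] in [delta rho tau], and hence equals it. *)
Lemma symbol_spec_linear (kappa : R) : kappa != 0 -> rho`_2 = 0 -> tau`_1 = kappa ->
  symbol_spec (kappa ^+ m) m rho m (dop (2 * m) e) e.
Proof.
move=> k0 rho2 tau1; pose X := dop (2 * m) e; pose D := delta rho tau.
have Xl : lin X := @lin_dop _ _ _.
have Dl : lin D := @lin_delta _ _ _.
have Da : adjointable u D := adjointable_delta up pe srho stau.
pose Q := \sum_(l < (2 * m).+1) (e l)`_l *: ffpoly l.
have QE n : (X 'X^n)`_n = Q.[n%:R] := dop_eigenvalue _ _ _.
(* [q] is [Q] rescaled so that [q] at the eigenvalue [kappa * n] equals [Q] at [n]. *)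
pose q := \poly_(i < size Q) (Q`_i / kappa ^+ i).
have qE x : q.[kappa * x] = Q.[x].
  rewrite horner_poly horner_coef; apply: eq_bigr => i _.
  by rewrite exprMn mulrA divfK // expf_neq0.
have qQ i : Q`_i = q`_i * kappa ^+ i.
  rewrite coef_poly; case: ltnP => [_|iQ]; first by rewrite divfK // expf_neq0.
  by rewrite mul0r nth_default.
have iterE i n : (iter i D 'X^n)`_n = (kappa * n%:R) ^+ i.
  elim: i => [|i IH] /=; first by rewrite coefXn eqxx.
  rewrite (degpres_coef Dl Da.1) ?IH.
    by rewrite delta_eigenvalue rho2 mul0r add0r tau1 exprSr.
  by apply: (adjointable_iter i Da).1; rewrite size_polyXn.
have polyopE n : (polyop q D 'X^n)`_n = Q.[n%:R].
  rewrite -qE horner_coef /polyop coef_sum; apply: eq_bigr => i _.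
  by rewrite coefZ iterE.
have XE f : X f = polyop q D f.
  pose Z f := (-1) *: polyop q D f + X f.
  suff : Z f = 0 by rewrite /Z scaleN1r addrC => /eqP; rewrite subr_eq0 => /eqP.
  have Pl := @lin_polyop _ q D Dl; have Pa := adjointable_polyop q up Da.
  have ZL : lin Z by move=> a g h; rewrite /Z Xl Pl -!mul_polyC; ring.
  apply: (lowering_adjointable0 up ZL (adjointable_lin (-1) up Pa Xa)) => n g sg.
  apply: size_leq_coef0; first exact: (adjointable_lin (-1) up Pa Xa).1.
  rewrite /Z coefD coefZ (degpres_coef (f := g) Xl Xa.1) // (degpres_coef (f := g) Pl Pa.1) //.
  by rewrite polyopE QE mulN1r addNr.
have top s a : (size q <= s.+1)%N ->
    (X (('X - a%:P) ^+ (2 * s))).[a] = q`_s * (2 * s)`!%:R * rho.[a] ^+ s.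
  move=> sq; rewrite XE /polyop.
  rewrite (big_ord_widen s.+1 (fun i => q`_i *: iter i D (('X - a%:P) ^+ (2 * s)))) //.
  rewrite big_mkcond /= horner_sum big_ord_recr /= big1 ?add0r => [|i _].
    have [r' r'a] := iter_delta_XsubC a s 0 1; rewrite addn0 mulr1 expr0 mul1r => iE.
    have -> : (if (s < size q)%N then q`_s *: iter s D (('X - a%:P) ^+ (2 * s)) else 0) =
        q`_s *: iter s D (('X - a%:P) ^+ (2 * s)).
      by case: ltnP => // qs; rewrite nth_default // scale0r.
    by rewrite hornerZ iE r'a addn0 ffactnn hornerC mulr1 mulrA.
  case: ifP => _; last by rewrite horner0.
  have [r' _] := iter_delta_XsubC a i (2 * (s - i)) 1.
  have -> : (2 * i + 2 * (s - i) = 2 * s)%N by have := ltn_ord i; lia.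
  rewrite mulr1 hornerZ => ->; rewrite hornerM horner_exp hornerXsubC subrr.
  have -> : (2 * (s - i) = (2 * (s - i)).-1.+1)%N by have := ltn_ord i; lia.
  by rewrite exprS !mul0r mulr0.
(* If the degree [s] of [q] exceeded [m], the test above would give a nonzero value where [rho.[a]
   != 0], while an operator of order [2m < 2s] gives zero. *)
have sq : (size q <= m.+1)%N.
  rewrite leqNgt; apply/negP => ms; have q0 : q != 0 by rewrite -size_poly_gt0 (leq_trans _ ms).
  have [a ra] := poly_neq0_eval r0; have := top (size q).-1 a (leqSpred _).
  rewrite /X horner_dop_XsubC ifF; last by apply/negbTE; rewrite -ltnNge; lia.
  apply/eqP; rewrite eq_sym; apply: mulf_neq0; last exact: expf_neq0.
  apply: mulf_neq0; first by rewrite -lead_coefE lead_coef_eq0.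
  by rewrite pnatr_eq0 -lt0n fact_gt0.
exists q`_m, Q; split=> //.
- apply/leq_sizeP => j mj; rewrite qQ nth_default ?mul0r //; exact: leq_trans sq mj.
- apply: poly_eval_inj => a; have := top m a sq; rewrite /X horner_dop_XsubC leqnn.
  rewrite hornerZ horner_exp -mulr_natr mulrAC => /mulIf; apply.
  by rewrite pnatr_eq0 -lt0n fact_gt0.
- by rewrite qQ mulrC.
Qed.

End Weight.
End LeadingSymbol.


(** * Operators intertwining two weights *)

Section OffDiagonal.
Context {R : realFieldType}.
Implicit Types (u : {poly R} -> R) (f g p q r s t y rho tau : {poly R}) (e : nat -> {poly R}).

(** For nonzero [q] and [y] the equation says that [q / y] has logarithmic derivative [t / rho].
    With [t = taui - tauj] this is the logarithmic derivative of [wi / wj], so rigidity expresses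
    that the quotient of the two weights is not a rational function. *)
Definition wronskian_rigid rho t :=
  forall q y, rho * (q^`() * y - q * y^`()) = t * (q * y) -> q * y = 0.

(** By degrees: the Wronskian of [q] and [y] has smaller degree than [q * y]. *)
Lemma wronskian_rigid_const (c : R) : c != 0 -> wronskian_rigid 1 c%:P.
Proof.
move=> c0 q y; rewrite mul1r mul_polyC => E; apply/eqP/negPn/negP => qy0.
have [q0 y0] : q != 0 /\ y != 0 by apply/andP; rewrite mulf_eq0 negb_or in qy0.
have : (size (q^`() * y - q * y^`())%R < size (q * y)%R)%N.
  rewrite (size_mul q0 y0); have sq := lt_size_deriv q0; have sy := lt_size_deriv y0.
  have q1 : (0 < size q)%N by rewrite size_poly_gt0.
  have y1 : (0 < size y)%N by rewrite size_poly_gt0.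
  apply: leq_ltn_trans (size_polyD _ _) _; rewrite gtn_max size_polyN.
  apply/andP; split; apply: leq_ltn_trans (size_polyMleq _ _) _.
    by move: sq q1 y1; move: (size q) (size y) (size q^`()) => x1 x2 x3; lia.
  by move: sy q1 y1; move: (size q) (size y) (size y^`()) => x1 x2 x3; lia.
by rewrite E size_scale // ltnn.
Qed.

Lemma mulX_deriv_XsubC (a : R) k h :
  ('X - a%:P) * (('X - a%:P) ^+ k * h)^`() =
  ('X - a%:P) ^+ k * (k%:R%:P * h + ('X - a%:P) * h^`()).
Proof.
case: k => [|k]; last by rewrite deriv_XsubC_exp exprS mulrA.
by rewrite expr0 !mul1r mul0r add0r.
Qed.

(* Both sides have a regular singularity at [a]; comparing the orders of vanishing of [q] and [y]
   there forces the residue [t.[a] / s.[a]] to be an integer. *)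
Lemma wronskian_rigid_root (a : R) s t :
  (forall k l : nat, s.[a] * (k%:R - l%:R) != t.[a]) -> wronskian_rigid (('X - a%:P) * s) t.
Proof.
move=> nz q y E; apply/eqP/negPn/negP => qy0.
have [q0 y0] : q != 0 /\ y != 0 by apply/andP; rewrite mulf_eq0 negb_or in qy0.
have [k [q1 q1a qE]] := multiplicity_XsubC q a; rewrite q0 /= in q1a.
have [l [y1 y1a yE]] := multiplicity_XsubC y a; rewrite y0 /= in y1a.
set Z := 'X - a%:P in qE yE E.
have dq : Z * q^`() = Z ^+ k * (k%:R%:P * q1 + Z * q1^`()).
  by rewrite qE [q1 * _]mulrC mulX_deriv_XsubC.
have dy : Z * y^`() = Z ^+ l * (l%:R%:P * y1 + Z * y1^`()).
  by rewrite yE [y1 * _]mulrC mulX_deriv_XsubC.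
have Z0 n : Z ^+ n != 0 by rewrite expf_neq0 // polyXsubC_eq0.
have : Z ^+ k * (Z ^+ l * (s * ((k%:R%:P * q1 + Z * q1^`()) * y1 - q1 * (l%:R%:P * y1 + Z * y1^`()))))
   = Z ^+ k * (Z ^+ l * (t * (q1 * y1))).
  transitivity (s * (Z * q^`() * y - q * (Z * y^`()))).
    by rewrite dq dy qE yE; ring.
  transitivity (Z * s * (q^`() * y - q * y^`())); first by ring.
  by rewrite E qE yE; ring.
move/(mulfI (Z0 k))/(mulfI (Z0 l))/(congr1 (fun p => p.[a])).
rewrite !hornerE /= subrr !mul0r !addr0 => E'.
have q1y1 : q1.[a] * y1.[a] != 0 by rewrite mulf_neq0.
have /eqP := nz k l; apply; apply: (mulIf q1y1); rewrite [RHS]mulrA -E'; ring.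
Qed.

Section Pair.
Variables (ui uj : {poly R} -> R) (rho taui tauj : {poly R}).
Hypotheses (ip : posfun ui) (jp : posfun uj).
Hypotheses (ipe : pearson ui rho taui) (jpe : pearson uj rho tauj).
Hypotheses (r0 : rho != 0) (rig : wronskian_rigid rho (taui - tauj)).

(** The Pearson equation moves a derivative only when it carries a factor [rho]. Each integration by
    parts uses up one such factor, hence [l <= k]. *)
Lemma ibp_derivn l k p : (l <= k)%N ->
  exists q, forall f, uj ((rho ^+ k * f)^`(l) * p) = uj (f * q).
Proof.
elim: l k => [|l IH] k lk.
  by exists (rho ^+ k * p) => f; rewrite derivn0 [rho ^+ k * f]mulrC mulrA.
case: k lk => // k lk; have [q hq] := IH k lk.
exists (k.+1%:R%:P * rho^`() * q - (tauj * q + rho * q^`())) => f.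
have -> : (rho ^+ k.+1 * f)^`(l.+1) = (rho ^+ k * (k.+1%:R%:P * rho^`() * f + rho * f^`()))^`(l).
  rewrite derivSn; congr derivn; rewrite derivM deriv_exp /= exprS.
  have -> (x : {poly R}) : x *+ k.+1 = k.+1%:R%:P * x by rewrite mul_polyC scaler_nat.
  ring.
rewrite hq mulrDl mulrBr posfunD // posfunB //; congr (_ + _); first by congr uj; ring.
apply/eqP; rewrite -subr_eq0 opprK -posfunD // -[X in _ == X](jpe (f * q)); apply/eqP.
congr uj; rewrite derivM; ring.
Qed.

(* Applying the hypothesis to [rho ^+ d * f] and integrating by parts turns it into
   [uj (f * q) = ui (f * Y)]; the two Pearson equations then force the Wronskian identity
   [rho * (q' Y - q Y') = (taui - tauj) * q Y]. *)
Lemma dop_transpose_eq0 d e g y :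
  (forall f, uj (dop d e f * g) = ui (f * y)) -> y = 0.
Proof.
move=> h.
have [q hq] : exists q, forall f, uj (dop d e (rho ^+ d * f) * g) = uj (f * q).
  suff H n : (n <= d.+1)%N -> exists q, forall f,
      uj ((\sum_(l < n) (rho ^+ d * f)^`(l) * e l) * g) = uj (f * q) by apply: H.
  elim: n => [_|n IH nd].
    by exists 0 => f; rewrite big_ord0 mul0r mulr0.
  have [q1 h1] := IH (ltnW nd); have [q2 h2] := @ibp_derivn n d (e n * g) nd.
  exists (q1 + q2) => f.
  by rewrite big_ord_recr /= mulrDl mulrDr !posfunD // h1 -mulrA h2.
have L f : uj (q * f) = ui (rho ^+ d * y * f).
  by rewrite mulrC -hq h; congr ui; ring.
set Y := rho ^+ d * y in L.
have Y0 : Y = 0.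
  have qY : q * Y = 0.
    have : q * (rho * (q^`() * Y - q * Y^`()) - (taui - tauj) * (q * Y)) = 0.
      apply: (posfun_faithful jp) => f.
      (* [Y * A] and [q * C] are the Pearson expressions of the two weights at [Y * (Y * q * f)] and
         [q * (q * Y * f)]. The extra factor [Y] or [q] lets [L] carry the first from [ui] to [uj];
         the difference [C - A] is [f] times the wanted Wronskian expression. *)
      pose A := taui * (Y * q * f) + rho * (2 * Y^`() * q * f + Y * q^`() * f + Y * q * f^`()).
      pose C := tauj * (Y * q * f) + rho * (2 * q^`() * Y * f + q * Y^`() * f + Y * q * f^`()).
      have hA : uj (q * A) = 0.
        by rewrite L -(ipe (Y * (Y * q * f))); congr ui; rewrite /A !derivM; ring.
      have hC : uj (q * C) = 0.
        by rewrite -(jpe (q * (q * Y * f))); congr uj; rewrite /C !derivM; ring.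
      rewrite -[RHS](subrr 0) -{1}hC -hA -posfunB //; congr uj; rewrite /A /C; ring.
    move/eqP; rewrite mulf_eq0 => /orP[/eqP->|]; first by rewrite mul0r.
    by rewrite subr_eq0 => /eqP/rig.
  move/eqP: qY; rewrite mulf_eq0 => /orP[/eqP q0|/eqP//].
  by apply: (posfun_faithful ip) => f; rewrite mulrC -L q0 mul0r posfun0.
by move/eqP: Y0; rewrite mulf_eq0 expf_eq0 (negPf r0) andbF => /eqP.
Qed.

End Pair.
End OffDiagonal.


(** * The matrix inner product as a scalar form on rows *)

Section RowForm.
Context {R : realFieldType} {N : nat}.
Local Notation vrow := {ffun 'I_N -> {poly R}}.
Variables (A : 'M[R]_N) (u : 'I_N -> {poly R} -> R).
Hypothesis A2 : forall i j k, A i j * A j k = 0.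
Hypothesis up : forall k, posfun (u k).
Implicit Types (v w : vrow) (f g : {poly R}).

(* Right multiplication by [1 + a x A]; since [A] squares to zero, [mulT (- a)] is its inverse. *)
Definition mulT (a : R) v : vrow := [ffun k => v k + a *: ('X * \sum_l A l k *: v l)].

Lemma mulT_lin a (c : R) v w : mulT a (c *: v + w) = c *: mulT a v + mulT a w.
Proof.
apply/ffunP => k; rewrite !ffunE.
have -> : \sum_l A l k *: (c *: v + w) l = c *: \sum_l A l k *: v l + \sum_l A l k *: w l.
  rewrite scaler_sumr -big_split /=; apply: eq_bigr => l _.
  by rewrite !ffunE scalerDr !scalerA mulrC.
by rewrite mulrDr -scalerAr !scalerDr !scalerA [a * c]mulrC addrACA.
Qed.

Lemma mulTK a v : mulT (- a) (mulT a v) = v.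
Proof.
apply/ffunP => k; rewrite !ffunE.
have -> : \sum_l A l k *: mulT a v l = \sum_l A l k *: v l.
  apply: eq_bigr => l _; rewrite ffunE scalerDr -[RHS]addr0; congr (_ + _).
  rewrite scalerA mulrC -scalerA scalerAr scaler_sumr big1 ?mulr0 ?scaler0 // => j _.
  by rewrite scalerA mulrC A2 scale0r.
by rewrite scaleNr addrK.
Qed.

Lemma mulTVK v : mulT 1 (mulT (-1) v) = v.
Proof. by have := mulTK (-1) v; rewrite opprK. Qed.

(** An entry of the matrix inner product involves one row of each factor, so this symmetric scalar
    form on rows carries all of it; [mulT 1] is the factor [T] of the weight. *)
Definition form v w : R := \sum_k u k (mulT 1 v k * mulT 1 w k).

Lemma form_linl (c : R) v w z : form (c *: v + w) z = c * form v z + form w z.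
Proof.
rewrite /form mulT_lin mulr_sumr -big_split /=; apply: eq_bigr => k _.
by rewrite !ffunE mulrDl -scalerAl posfunD // posfunZ.
Qed.

Lemma formC v w : form v w = form w v.
Proof. by apply: eq_bigr => k _; rewrite mulrC. Qed.

Lemma form_pos v : v != 0 -> 0 < form v v.
Proof.
move=> v0; have ge k f : 0 <= u k (f * f).
  by have [->|/((up k).2)/ltW//] := eqVneq f 0; rewrite mul0r posfun0.
have /existsP[k vk] : [exists k, mulT 1 v k != 0].
  apply: contraNT v0; rewrite negb_exists => /forallP h.
  rewrite -(mulTK 1 v) (_ : mulT 1 v = 0); last first.
    by apply/ffunP => k; rewrite [RHS]ffunE; apply/eqP/negPn; exact: h.
  apply/eqP/ffunP => k; rewrite !ffunE big1 ?mulr0 ?scaler0 ?addr0 // => l _.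
  by rewrite ffunE scaler0.
rewrite /form (bigD1 k) //= ltr_pwDl ?(up k).2 // sumr_ge0 // => l _; exact: ge.
Qed.

Definition single (i : 'I_N) f : vrow := [ffun k => if k == i then f else 0].

Lemma single_sum (F : 'I_N -> 'I_N -> R) i f k :
  \sum_l F l k *: single i f l = F i k *: f.
Proof.
rewrite (bigD1 i) //= ffunE eqxx big1 ?addr0 // => l /negPf li.
by rewrite ffunE li scaler0.
Qed.

Lemma mulT_single a i f k : mulT a (single i f) k = (if k == i then f else 0) + a *: ('X * (A i k *: f)).
Proof. by rewrite ffunE (single_sum A) ffunE. Qed.

Definition dg n v := forall k, (size (v k) <= n)%N.

Definition row_monomials n : seq vrow :=
  [seq single i 'X^k | k <- iota 0 n, i <- enum 'I_N].

Lemma row_sum_single v : v = \sum_i single i (v i).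
Proof.
apply/ffunP => k; rewrite sum_ffunE (bigD1 k) //= ffunE eqxx big1 ?addr0 // => i ik.
by rewrite ffunE eq_sym (negPf ik).
Qed.

Lemma single_lin i (c : R) f g : single i (c *: f + g) = c *: single i f + single i g.
Proof. by apply/ffunP => k; rewrite !ffunE; case: ifP => _ //; rewrite scaler0 addr0. Qed.

Lemma span_row_monomials n v : dg n v -> in_span (row_monomials n) v.
Proof.
move=> vn; rewrite [v]row_sum_single; apply: in_span_sum => i _.
elim: (span_monomials (vn i)) => [|c f g _ hf _ hg|f /mapP[k kn ->]].
- rewrite (_ : single i 0 = 0); first exact: in_span0.
  by apply/ffunP => k; rewrite !ffunE if_same.
- by rewrite single_lin; apply: in_span_lin.
- by apply/in_span_mem/allpairsP; exists (k, i); rewrite mem_enum.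
Qed.

Lemma dg_lin n (c : R) v w : dg n v -> dg n w -> dg n (c *: v + w).
Proof.
move=> hv hw k; rewrite !ffunE; apply: leq_trans (size_polyD _ _) _.
by rewrite geq_max hw andbT (leq_trans (size_scale_leq _ _)).
Qed.

Lemma dg0 n : dg n 0.
Proof. by move=> k; rewrite ffunE size_poly0. Qed.

Lemma dg_single n i f : (size f <= n)%N -> dg n (single i f).
Proof. by move=> sf k; rewrite ffunE; case: ifP; rewrite ?size_poly0. Qed.

Lemma dg_span n v : in_span (row_monomials n) v -> dg n v.
Proof.
elim=> [|c x y _ hx _ hy|x /allpairsP[[k i] /= [kn _ ->]]]; first exact: dg0.
- exact: dg_lin.
- by apply: dg_single; move: kn; rewrite mem_iota size_polyXn.
Qed.

Lemma riesz_row n (phi : vrow -> R) :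
  (forall (c : R) v w, phi (c *: v + w) = c * phi v + phi w) ->
  exists2 w, dg n w & forall v, dg n v -> form v w = phi v.
Proof.
move=> phil.
have [w /dg_span wn hw] := riesz_span form_linl formC form_pos (row_monomials n) phil.
by exists w => // v /span_row_monomials; apply: hw.
Qed.

Definition monic_orthogonal (P : nat -> 'I_N -> vrow) :=
  (forall n i j, (size (P n i j) <= n.+1)%N /\ (P n i j)`_n = (i == j)%:R) /\
  (forall n m, n <> m -> forall i j, form (P n i) (P m j) = 0).

(** Each row is ['X^n] in one place minus its orthogonal projection on the rows of lower degree.
    Existence matters because the eigenvalue hypothesis speaks only of such sequences. *)
Lemma monic_orthogonal_exists : exists P, monic_orthogonal P.
Proof.
have ex n i : exists p : vrow, dg n p /\ forall v, dg n v -> form v p = form v (single i 'X^n).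
  have [p pn hp] := riesz_row n (fun c v w => form_linl c v w (single i 'X^n)).
  by exists p.
have [p hp] : exists p : nat -> 'I_N -> vrow, forall n i, dg n (p n i) /\
    forall v, dg n v -> form v (p n i) = form v (single i 'X^n).
  have [p hp] := boolp.choice (fun x : nat * 'I_N => ex x.1 x.2).
  by exists (fun n i => p (n, i)) => n i; apply: (hp (n, i)).
pose P n i := single i 'X^n - p n i.
have dP n i : dg n.+1 (P n i).
  move=> j; rewrite !ffunE; apply: leq_trans (size_polyD _ _) _; rewrite geq_max size_polyN.
  rewrite (leq_trans ((hp n i).1 j)) // andbT; case: ifP => _; last by rewrite size_poly0.
  by rewrite size_polyXn.
have oP n i v : dg n v -> form v (P n i) = 0.
  move=> vn; rewrite /P addrC -scaleN1r (form_linr form_linl formC) (hp n i).2 //.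
  by rewrite mulN1r addNr.
exists P; split=> [n i j|n m nm i j].
  split; first exact: dP.
  rewrite !ffunE coefB [(p n i j)`_n]nth_default ?subr0; last exact: (hp n i).1.
  by rewrite eq_sym; case: eqP; rewrite ?coefXn ?eqxx ?coef0.
have [mn|mn|mn] := ltngtP m n; last by case: nm.
  by rewrite formC oP // => k; apply: leq_trans (dP m j k) _.
by rewrite oP // => k; apply: leq_trans (dP n i k) _.
Qed.

(** Since [P n] is monic, subtracting the combination of its rows with the top coefficients of [v]
    lowers the degree; thus the orthogonal rows span everything. *)
Lemma monic_orthogonal_ind P (S : vrow -> Prop) : monic_orthogonal P ->
  S 0 -> (forall (c : R) v w, S v -> S w -> S (c *: v + w)) ->
  forall n, (forall k i, (k < n)%N -> S (P k i)) -> forall v, dg n v -> S v.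
Proof.
move=> [Pm _] S0 SL; elim=> [|n IH] SP v vn.
  rewrite (_ : v = 0) //; apply/ffunP => k; rewrite ffunE.
  by apply/eqP; rewrite -size_poly_eq0 -leqn0 vn.
pose w := \sum_i (v i)`_n *: P n i.
have Sw : S w.
  apply: (big_ind S) => // [x y Sx Sy|i _]; first by rewrite -[x]scale1r; apply: SL.
  by rewrite -[_ *: _]addr0; apply: SL => //; apply: SP.
rewrite -[v](subrK w) -[_ - _]scale1r; apply: (SL 1) => //.
apply: IH => [k i kn|k]; first by apply: SP; apply: ltnW.
rewrite !ffunE sum_ffunE; apply: size_leq_coef0.
  apply: leq_trans (size_polyD _ _) _; rewrite geq_max vn size_polyN /=.
  apply: leq_trans (size_sum _ _ _) _; apply/bigmax_leqP => i _; rewrite ffunE.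
  by apply: leq_trans (size_scale_leq _ _) _; case: (Pm n i k).
rewrite coefB coef_sum (bigD1 k) //= ffunE coefZ (Pm n k k).2 eqxx mulr1 big1 ?addr0 ?subrr //.
by move=> i /negPf ik; rewrite ffunE coefZ (Pm n i k).2 ik mulr0.
Qed.

End RowForm.


(** * Leading coefficients of operators given extensionally *)

Section HasSymbol.
Context {R : realFieldType}.
Implicit Types (X Y : {poly R} -> {poly R}) (p t : {poly R}).

(** The order is at most [d] and [t] may be zero. The entries of the conjugated operator are known
    only as functions, so the leading coefficient is a relation, unique by [has_symbol_inj]. *)
Definition has_symbol d X t := exists2 e, e d = t & forall f, X f = dop d e f.

Lemma has_symbol_dop d e : has_symbol d (dop d e) (e d).
Proof. by exists e. Qed.

Lemma has_symbol_ext d X Y t : (forall f, X f = Y f) -> has_symbol d Y t -> has_symbol d X t.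
Proof. by move=> XY [e ed Ye]; exists e => // f; rewrite XY. Qed.

Lemma has_symbolD d X Y t t' : has_symbol d X t -> has_symbol d Y t' ->
  has_symbol d (fun f => X f + Y f) (t + t').
Proof.
move=> [e ed Xe] [e' e'd Ye']; exists (fun l => e l + e' l) => [|f]; first by rewrite ed e'd.
by rewrite Xe Ye' /dop -big_split; apply: eq_bigr => l _; rewrite mulrDr.
Qed.

Lemma has_symbolM d p X t : has_symbol d X t -> has_symbol d (fun f => p * X f) (p * t).
Proof.
move=> [e ed Xe]; exists (fun l => p * e l) => [|f]; first by rewrite ed.
by rewrite Xe /dop mulr_sumr; apply: eq_bigr => l _; rewrite mulrCA.
Qed.

Lemma has_symbol0 d : has_symbol d (fun=> 0) 0.
Proof. by exists (fun=> 0) => // f; rewrite /dop big1 // => l _; rewrite mulr0. Qed.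

Lemma has_symbol_sum d (I : Type) (r : seq I) (X : I -> {poly R} -> {poly R})
    (t : I -> {poly R}) :
  (forall i, has_symbol d (X i) (t i)) ->
  has_symbol d (fun f => \sum_(i <- r) X i f) (\sum_(i <- r) t i).
Proof.
move=> h; elim: r => [|i r IH].
  by rewrite big_nil; apply: has_symbol_ext (has_symbol0 d) => f; rewrite big_nil.
rewrite big_cons; apply: has_symbol_ext (has_symbolD (h i) IH) => f.
by rewrite big_cons.
Qed.

Lemma derivnMX (f : {poly R}) l : ('X * f)^`(l) = 'X * f^`(l) + f^`(l.-1) *+ l.
Proof.
elim: l => [|l IH]; first by rewrite mulr0n addr0.
rewrite derivnS IH derivD derivM derivX mul1r derivMn -derivnS.
case: l {IH} => [|l] /=; first by rewrite !mulr0n addr0 addrC mulr1n.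
rewrite -!derivnS [in RHS]mulrS; move: (f^`(l.+1)) (f^`(l.+2)) (_ *+ _) => a b c; ring.
Qed.

Lemma has_symbolX d X t : has_symbol d X t -> has_symbol d (fun f => X ('X * f)) ('X * t).
Proof.
(* By the Leibniz rule the derivative of order [l + 1] of ['X * f] contributes [(l + 1) f^(l)]; at
   the top order nothing is added. *)
move=> [e ed Xe]; pose e' l := 'X * e l + (if (l < d)%N then e l.+1 *+ l.+1 else 0).
exists e' => [|f]; first by rewrite /e' ed ltnn addr0.
rewrite Xe /dop.
under eq_bigr do rewrite derivnMX mulrDl.
under [RHS]eq_bigr do rewrite mulrDr.
rewrite !big_split /=; congr (_ + _).
  by apply: eq_bigr => l _; rewrite mulrA [f^`(l) * _]mulrC.
rewrite big_ord_recl [RHS]big_ord_recr /= ltnn mulr0 addr0 mulr0n mul0r add0r.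
by apply: eq_bigr => l _; rewrite ltn_ord /bump /= add1n mulrnAl mulrnAr.
Qed.

Lemma has_symbol_inj d X t t' : has_symbol d X t -> has_symbol d X t' -> t = t'.
Proof.
move=> [e <- Xe] [e' <- Xe']; apply: poly_eval_inj => a.
have := horner_dop_XsubC d e a d; rewrite -Xe Xe' horner_dop_XsubC leqnn.
by move/(pmulrnI (fact_gt0 d)).
Qed.

End HasSymbol.

(** * The conjugated operator and the existence of the adjoint *)

Section Core.
Context {R : realFieldType} {N : nat}.
Local Notation vrow := {ffun 'I_N -> {poly R}}.
Variables (A : 'M[R]_N) (u : 'I_N -> {poly R} -> R).
Hypothesis A2 : forall i j k, A i j * A j k = 0.
Hypothesis up : forall k, posfun (u k).
Implicit Types (v w : vrow) (f g : {poly R}).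
Local Notation B := (form A u).
Local Notation mulT := (mulT A).

Definition act d (F : nat -> 'M[{poly R}]_N) v : vrow :=
  [ffun k => \sum_s dop d (fun l => F l s k) (v s)].

Variables (d : nat) (F : nat -> 'M[{poly R}]_N).
Local Notation D := (act d F).

Lemma act_lin (c : R) v w : D (c *: v + w) = c *: D v + D w.
Proof.
apply/ffunP => k; rewrite !ffunE scaler_sumr -big_split /=; apply: eq_bigr => s _.
by rewrite !ffunE lin_dop.
Qed.

(** Operators act on the right: a row supported at [i] is multiplied by the inverse of [T], acted on
    by [D], multiplied by [T], and read at [j]. *)
Definition entry i j f := mulT 1 (D (mulT (-1) (single i f))) j.

(** Multiplication by [x] changes the top coefficient only by the factor [x], so the symbol is the
    corresponding entry of [(1 - x A) F_d (1 + x A)]. *)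
Lemma entry_has_symbol i j : has_symbol d (entry i j)
  (let G k := \sum_s ((s == i)%:R * F d s k + (- A i s)%:P * ('X * F d s k)) in
   G j + \sum_l ((A l j)%:P * 'X) * G l).
Proof.
pose H k f := \sum_s ((s == i)%:R * dop d (fun l => F l s k) f +
  (- A i s)%:P * dop d (fun l => F l s k) ('X * f)).
have HE k f : D (mulT (-1) (single i f)) k = H k f.
  rewrite ffunE; apply: eq_bigr => s _; rewrite mulT_single.
  rewrite (linD _ _ (@lin_dop _ _ _)) mul_polyC -(linZ _ _ (@lin_dop _ _ _)).
  rewrite scalerAr scalerA mulN1r -scalerAr; congr (_ + _).
  case: eqP => _; first by rewrite mul1r.
  by rewrite mul0r lin0 //; apply: lin_dop.
have Hs k : has_symbol d (H k) (\sum_s ((s == i)%:R * F d s k + (- A i s)%:P * ('X * F d s k))).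
  apply: has_symbol_sum => s; apply: has_symbolD; apply: has_symbolM.
    exact: has_symbol_dop.
  by apply: has_symbolX; apply: has_symbol_dop.
apply: has_symbol_ext (has_symbolD (Hs j)
  (has_symbol_sum _ (fun l => has_symbolM ((A l j)%:P * 'X) (Hs l)))) => f.
rewrite /entry ffunE HE scale1r mulr_sumr; congr (_ + _); apply: eq_bigr => l _.
by rewrite HE -mul_polyC mulrA ['X * _]mulrC.
Qed.

(** A scalar matrix is fixed by conjugation. Here [G] is [(1 - x A) F_d]; the hypothesis makes it
    [M (1 - x A)], and multiplying by [1 + x A] on the left returns [F_d]. *)
Lemma lead_coef_of_entries (M : {poly R}) :
  (forall i j, has_symbol d (entry i j) (if j == i then M else 0)) -> F d = M%:M.
Proof.
move=> h; have A2P i j k : (A i j)%:P * (A j k)%:P = 0 :> {poly R} by rewrite -polyCM A2.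
pose G i k := F d i k - \sum_s (A i s)%:P * ('X * F d s k).
have GE i k : \sum_s ((s == i)%:R * F d s k + (- A i s)%:P * ('X * F d s k)) = G i k.
  rewrite big_split /= (bigD1 i) //= eqxx mul1r big1 ?addr0 => [|s /negPf->]; last by rewrite mul0r.
  by rewrite /G -sumrN; congr (_ + _); apply: eq_bigr => s _; rewrite polyCN mulNr.
have G1 i : mulT 1 [ffun k => G i k] = single i M.
  apply/ffunP => j; rewrite !ffunE -(has_symbol_inj (entry_has_symbol i j) (h i j)) /=.
  rewrite GE scale1r mulr_sumr; congr (_ + _); apply: eq_bigr => l _.
  by rewrite GE ffunE -mul_polyC mulrA ['X * _]mulrC.
have G2 i k : G i k = (k == i)%:R * M - (A i k)%:P * ('X * M).
  have := mulTK A2 1 [ffun k => G i k]; rewrite G1 => /ffunP/(_ k).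
  rewrite mulT_single [RHS]ffunE => <-; rewrite scaleN1r -mul_polyC mulrCA.
  by case: eqP; rewrite ?mul1r ?mul0r.
have FG i k : F d i k = G i k + \sum_j (A i j)%:P * ('X * G j k).
  have -> : \sum_j (A i j)%:P * ('X * G j k) = \sum_j (A i j)%:P * ('X * F d j k).
    apply: eq_bigr => j _; rewrite /G !mulrBr [X in _ - X](_ : _ = 0) ?subr0 //.
    rewrite !mulr_sumr big1 // => s _.
    transitivity ((A i j)%:P * (A j s)%:P * ('X * 'X * F d s k)); first by ring.
    by rewrite A2P mul0r.
  by rewrite /G subrK.
apply/matrixP => i k; rewrite !mxE FG G2.
have -> : \sum_j (A i j)%:P * ('X * G j k) = (A i k)%:P * ('X * M).
  rewrite (bigD1 k) //= big1 ?addr0 => [|j /negPf jk].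
    rewrite G2 eqxx mul1r; transitivity ((A i k)%:P * ('X * M) -
      (A i k)%:P * (A k k)%:P * ('X * 'X * M)); first by ring.
    by rewrite A2P mul0r subr0.
  rewrite G2 eq_sym jk mul0r; transitivity (- ((A i j)%:P * (A j k)%:P * ('X * 'X * M))).
    by ring.
  by rewrite A2P mul0r oppr0.
by rewrite subrK eq_sym; case: eqP => _; rewrite ?mul1r ?mul0r.
Qed.

Hypothesis eig : forall P, monic_orthogonal A u P ->
  forall n i, exists L : 'I_N -> R, D (P n i) = \sum_j L j *: P n j.

Lemma act0 : D 0 = 0.
Proof. by have := act_lin (-1) 0 0; rewrite scaler0 addr0 scaleN1r addNr. Qed.

Lemma dg_sum n (L : 'I_N -> R) (P : 'I_N -> vrow) :
  (forall j, dg n (P j)) -> dg n (\sum_j L j *: P j).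
Proof.
move=> h; apply: (big_ind (dg n)); first exact: dg0.
  by move=> x y hx hy; rewrite -[x]scale1r; apply: dg_lin.
by move=> j _; rewrite -[_ *: _]addr0; apply: dg_lin => //; apply: dg0.
Qed.

Lemma act_dg n v : dg n v -> dg n (D v).
Proof.
have [P oP] := monic_orthogonal_exists A2 up.
apply: (monic_orthogonal_ind (S := fun v => dg n (D v)) oP) => [|c x y hx hy|k i kn].
- by rewrite act0; apply: dg0.
- by rewrite act_lin; apply: dg_lin.
- have [L ->] := eig oP k i; apply: dg_sum => j l.
  by apply: leq_trans kn; case: (oP.1 k j l).
Qed.

Lemma form0l v : B 0 v = 0.
Proof. by have := form_linl A up (-1) 0 0 v; rewrite scaler0 addr0 mulN1r addNr. Qed.

Lemma monic_orthogonal_dg P n k i w : monic_orthogonal A u P -> (n <= k)%N -> dg n w ->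
  B w (P k i) = 0.
Proof.
move=> oP nk; apply: (monic_orthogonal_ind (S := fun w => B w (P k i) = 0) oP).
- exact: form0l.
- by move=> c x y hx hy; rewrite form_linl // hx hy mulr0 addr0.
- by move=> l j ln; apply: oP.2 => lk; move: (leq_trans ln nk); rewrite lk ltnn.
Qed.

(** Riesz gives [w'] on rows of degree below [n]. It works for every [v]: on an orthogonal row of
    index [l >= n] both sides vanish, as [D] maps it to a combination of rows of the same index. *)
Lemma act_adj n w : dg n w -> exists2 w', dg n w' & forall v, B (D v) w = B v w'.
Proof.
have [P oP] := monic_orthogonal_exists A2 up => wn.
have phil (c : R) x y : B (D (c *: x + y)) w = c * B (D x) w + B (D y) w.
  by rewrite act_lin form_linl.
have [w' w'n hw'] := riesz_row A2 up n phil; exists w' => // v.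
have [k vk] : exists k, dg k v.
  exists (\max_j size (v j))%N => j; exact: (leq_bigmax j).
apply: (monic_orthogonal_ind (S := fun v => B (D v) w = B v w') oP _ _ _ vk).
- by rewrite act0 !form0l.
- by move=> c x y hx hy; rewrite phil form_linl // hx hy.
move=> l i _; have [ln|nl] := ltnP l n.
  by rewrite hw' // => j; apply: leq_trans ln; case: (oP.1 l i j).
rewrite [RHS]formC (monic_orthogonal_dg _ oP nl w'n).
have [L ->] := eig oP l i.
apply: (big_ind (fun x => B x w = 0)) => [|x y hx hy|j _]; first exact: form0l.
  by rewrite -[x]scale1r form_linl // hx hy mulr0 addr0.
rewrite -[_ *: _]addr0 form_linl // form0l addr0 formC.
by rewrite (monic_orthogonal_dg _ oP nl wn) mulr0.
Qed.

End Core.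


(** * Diagonality, and equality of the constants along the diagonal *)

Section ScalarLeadCoef.
Context {R : realFieldType} {N : nat}.
Local Notation vrow := {ffun 'I_N -> {poly R}}.
Variables (A : 'M[R]_N) (u : 'I_N -> {poly R} -> R).
Hypothesis A2 : forall i j k, A i j * A j k = 0.
Hypothesis up : forall k, posfun (u k).
Variables (rho : {poly R}) (tau : 'I_N -> {poly R}).
Hypotheses (r0 : rho != 0) (pe : forall k, pearson (u k) rho (tau k)).
Hypothesis rig : forall i j, i != j -> wronskian_rigid rho (tau i - tau j).
Variables (m : nat) (F : nat -> 'M[{poly R}]_N).
Local Notation D := (act (2 * m) F).
Hypothesis eig : forall P, monic_orthogonal A u P ->
  forall n i, exists L : 'I_N -> R, D (P n i) = \sum_j L j *: P n j.
Implicit Types (f g : {poly R}).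
Local Notation B := (form A u).
Local Notation mulT := (mulT A).
Local Notation E := (entry A (2 * m) F).

Lemma A_diag i : A i i = 0.
Proof. by have /eqP := A2 i i i; rewrite mulf_eq0 orbb => /eqP. Qed.

(** The form sums over all components; this extracts a scalar adjoint relation whenever only
    component [j] survives, because of the support of either factor. *)
Lemma entry_adj i j f w w' : (forall v, B (D v) w = B v w') ->
  (forall k, mulT 1 (D (mulT (-1) (single i f))) k * mulT 1 w k =
             if k == j then E i j f * mulT 1 w j else 0) ->
  u j (E i j f * mulT 1 w j) = u i (f * mulT 1 w' i).
Proof.
move=> h hE; have := h (mulT (-1) (single i f)); rewrite /form mulTVK //.
rewrite (bigD1 j) //= hE eqxx big1 => [|k /negPf kj]; last by rewrite hE kj posfun0.
rewrite addr0 => ->; rewrite (bigD1 i) //= ffunE eqxx big1 ?addr0 // => k /negPf ki.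
by rewrite ffunE ki mul0r posfun0.
Qed.

Lemma entry_offdiag i j f : i != j -> E i j f = 0.
Proof.
move=> ij; apply: (posfun_faithful (up j)) => g; rewrite mulrC.
(* This row is chosen so that its product with [T] is [g] at [j] and zero elsewhere. *)
have [n gn] : exists n, dg n (mulT (-1) (single j g)).
  by exists (\max_k size (mulT (-1) (single j g) k))%N => k; exact: (leq_bigmax k).
have [w' _ hw'] := act_adj A2 up eig gn.
have h f' : u j (E i j f' * g) = u i (f' * mulT 1 w' i).
  have := entry_adj (i := i) (j := j) (f := f') hw'.
  rewrite mulTVK // [single _ _ j]ffunE eqxx; apply => k; rewrite [single _ _ k]ffunE.
  case: eqP => [->//|_].
  by rewrite mulr0.
have [e _ Ee] := entry_has_symbol A (2 * m) F i j.
rewrite h (_ : mulT 1 w' i = 0) ?mulr0 ?posfun0 //.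
apply: (dop_transpose_eq0 (up i) (up j) (pe i) (pe j) r0 (rig ij) (d := 2 * m) (e := e)).
by move=> f'; rewrite -h Ee.
Qed.

Lemma act_single i f : D (mulT (-1) (single i f)) = mulT (-1) (single i (E i i f)).
Proof.
rewrite -[LHS](mulTK A2 1); congr mulT; apply/ffunP => k; rewrite [RHS]ffunE.
by case: eqP => [->//|/eqP ki]; apply: entry_offdiag; rewrite eq_sym.
Qed.

Lemma lin_row_sum (G : vrow -> vrow) (H : 'I_N -> vrow) :
  (forall (c : R) v w, G (c *: v + w) = c *: G v + G w) -> G (\sum_i H i) = \sum_i G (H i).
Proof.
move=> Gl; apply: big_morph => [x y|].
  by have := Gl 1 x y; rewrite !scale1r.
by have := Gl (-1) 0 0; rewrite scaler0 addr0 scaleN1r addNr.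
Qed.

Lemma lin_entry i j : lin (E i j).
Proof. by have [e _ Ee] := entry_has_symbol A (2 * m) F i j => a f g; rewrite !Ee lin_dop. Qed.

Lemma act_diag v : D (mulT (-1) v) = mulT (-1) [ffun k => E k k (v k)].
Proof.
rewrite {1}[v]row_sum_single lin_row_sum; last by move=> c x y; rewrite mulT_lin.
rewrite lin_row_sum; last exact: act_lin.
under eq_bigr do rewrite act_single.
rewrite -lin_row_sum; last by move=> c x y; rewrite mulT_lin.
congr mulT; apply/ffunP => k; rewrite ffunE sum_ffunE (bigD1 k) //= ffunE eqxx big1 ?addr0 //.
by move=> l /negPf lk; rewrite ffunE eq_sym lk.
Qed.

(** The diagonal operator conjugated back: terms quadratic in [A] vanish, leaving a diagonal part
    and a defect of commutation with [x] wherever [A] is nonzero. Preservation of degrees by [D]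
    then constrains both. *)
Lemma act_single1 i f k : D (single i f) k = (if k == i then E i i f else 0) +
  A i k *: (E k k ('X * f) - 'X * E i i f).
Proof.
have El l : lin (E l l) := lin_entry l l.
have vE l : mulT 1 (single i f) l = A i l *: ('X * f) + (if l == i then f else 0).
  by rewrite mulT_single scale1r addrC scalerAr.
have XE l : E l l (mulT 1 (single i f) l) =
    A i l *: E l l ('X * f) + (if l == i then E i i f else 0).
  by rewrite vE El; case: eqP => [->//|_]; rewrite lin0.
rewrite -{1}[single i f](mulTK A2 1) act_diag; set W := [ffun l => _].
have WE l : W l = A i l *: E l l ('X * f) + (if l == i then E i i f else 0) by rewrite [LHS]ffunE XE.
rewrite [mulT _ W k]ffunE WE.
have -> : \sum_l A l k *: W l = A i k *: E i i f.
  rewrite (bigD1 i) //= WE eqxx A_diag scale0r add0r big1 ?addr0 // => l /negPf li.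
  by rewrite WE li addr0 scalerA mulrC A2 scale0r.
rewrite scaleN1r -scalerAr scalerBr addrA; congr (_ - _); exact: addrC.
Qed.

Lemma entry_degpres i : degpres (E i i).
Proof.
move=> n f sf; have := act_dg A2 up eig (dg_single i sf) i.
by rewrite act_single1 eqxx A_diag scale0r addr0.
Qed.

(** Each of the two terms may have one degree more, so their top coefficients agree: the eigenvalue
    of entry [j] at [n + 1] is that of entry [i] at [n]. *)
Lemma entry_shift i j n f : A i j != 0 -> (size f <= n)%N ->
  (size (E j j ('X * f) - 'X * E i i f)%R <= n)%N.
Proof.
move=> Aij sf; have ji : (j == i) = false.
  by apply: contraNF Aij => /eqP->; rewrite A_diag.
have := act_dg A2 up eig (dg_single i sf) j.
by rewrite act_single1 ji add0r size_scale.
Qed.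

(* The column part of the adjoint that could raise the degree vanishes, because [A] squares to
   zero. *)
Lemma entry_adjointable i : adjointable (u i) (E i i).
Proof.
split; first exact: entry_degpres.
move=> n g sg; have [w' w'n hw'] := act_adj A2 up eig (dg_single i sg).
have mul l : mulT 1 (single i g) l = (if l == i then g else 0) + A i l *: ('X * g).
  by rewrite mulT_single scale1r scalerAr.
have h l f : u l (E l l f * mulT 1 (single i g) l) = u l (f * mulT 1 w' l).
  apply: (entry_adj (i := l) (j := l)) => // k.
  rewrite act_single mulTVK // ffunE; case: eqP => [->//|_]; last by rewrite mul0r.
have wl l : A l i *: mulT 1 w' l = 0.
  have [->|Ali] := eqVneq (A l i) 0; first by rewrite scale0r.
  have li : (l == i) = false by apply: contraNF Ali => /eqP->; rewrite A_diag.
  have Ail : A i l = 0 by have /eqP := A2 l i l; rewrite mulf_eq0 (negPf Ali) => /eqP.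
  suff -> : mulT 1 w' l = 0 by rewrite scaler0.
  apply: (posfun_faithful (up l)) => f; rewrite -h mul li Ail scale0r addr0 mulr0.
  exact: posfun0.
have w'i : w' i = mulT 1 w' i.
  rewrite -{1}(mulTK A2 1 w') ffunE [X in 'X * X]big1 ?mulr0 ?scaler0 ?addr0 // => l _.
exists (w' i); first exact: w'n.
by move=> f; rewrite w'i -h mul eqxx A_diag scale0r addr0.
Qed.

Variables (theta : R) (k : nat).
Hypothesis th0 : theta != 0.
Hypothesis spec : forall i e, adjointable (u i) (dop (2 * m) e) ->
  symbol_spec theta k rho m (dop (2 * m) e) e.
Hypothesis conn : forall i j : 'I_N, (j : nat) = i.+1 -> (A i j != 0) \/ (A j i != 0).

Lemma lead_coef_scalar : exists c : R, F (2 * m)%N = (c *: rho ^+ m)%:M.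
Proof.
have sp i : exists cQ : R * {poly R}, [/\ (size cQ.2 <= k.+1)%N,
    forall n, (E i i 'X^n)`_n = cQ.2.[n%:R],
    has_symbol (2 * m) (E i i) (cQ.1 *: rho ^+ m) & cQ.2`_k = theta * cQ.1].
  have [e _ Ee] := entry_has_symbol A (2 * m) F i i.
  have ae : adjointable (u i) (dop (2 * m) e).
    have [dE aE] := entry_adjointable i; split=> [n f sf|n g /aE[y sy hy]].
      by rewrite -Ee; apply: dE.
    by exists y => // f; rewrite -Ee.
  have [c [Q [sQ QE ec Qk]]] := spec ae.
  exists (c, Q); split=> // [n|]; first by rewrite Ee QE.
  by exists e.
have step i j c (Q : {poly R}) c' (Q' : {poly R}) : A i j != 0 ->
    (size Q <= k.+1)%N -> (forall n, (E i i 'X^n)`_n = Q.[n%:R]) -> Q`_k = theta * c ->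
    (size Q' <= k.+1)%N -> (forall n, (E j j 'X^n)`_n = Q'.[n%:R]) -> Q'`_k = theta * c' -> c = c'.
  move=> Aij sQ QE Qk sQ' QE' Qk'; apply: (mulfI th0); rewrite -Qk -Qk'.
  (* The eigenvalue relation holds at every natural number, hence as a polynomial identity. *)
  have QQ : Q = Q' \Po ('X + 1%:P).
    apply/eqP; rewrite -subr_eq0; apply/negPn/negP => /poly_neq0_nat[n].
    rewrite hornerD hornerN horner_comp !hornerE -QE -[n%:R + 1](natrD _ n 1) addn1 -QE'.
    have := entry_shift (n := n.+1) (f := 'X^n) Aij; rewrite size_polyXn -exprS => /(_ (leqnn _)).
    move/(nth_default 0); rewrite coefB coefXM /= => /eqP; rewrite subr_eq0 => /eqP->.
    by rewrite subrr eqxx.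
  (* Translation maps ['X^k] to a monic polynomial of the same degree, so it keeps coefficient [k]
     of a polynomial of degree at most [k]. *)
  pose X (p : {poly R}) := p \Po ('X + 1%:P).
  have Xl : lin X by move=> a f g; rewrite /X comp_polyD comp_polyZ.
  have X1 : size ('X + 1%:P : {poly R}) = 2 by rewrite size_XaddC.
  have Xd : degpres X.
    by move=> n f sf; rewrite /X size_comp_poly2 //.
  rewrite QQ (degpres_coef Xl Xd) // /X comp_Xn_poly.
  have /monicP := monic_exp k (monicXaddC (1 : R)).
  by rewrite lead_coefE size_exp size_XaddC mul1n => ->; rewrite mulr1.
have [c hc] : exists c : R, forall i, has_symbol (2 * m) (E i i) (c *: rho ^+ m).
  have [cQ hcQ] := boolp.choice sp.
  have next (i j : 'I_N) : (j : nat) = i.+1 -> (cQ i).1 = (cQ j).1.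
    have [sQ QE _ Qk] := hcQ i; have [sQ' QE' _ Qk'] := hcQ j.
    (* The nonzero entry of [A] may point either way, and the shift of the degree follows it. *)
    case/conn => Aij; first exact: (step _ _ _ _ _ _ Aij sQ QE Qk sQ' QE' Qk').
    exact/esym/(step _ _ _ _ _ _ Aij sQ' QE' Qk' sQ QE Qk).
  have all_eq n (i j : 'I_N) : (j : nat) = (i + n)%N -> (cQ i).1 = (cQ j).1.
    elim: n j => [|n IH] j jE; first by congr (cQ _).1; apply: val_inj; rewrite /= jE addn0.
    have lt : (i + n < N)%N by apply: leq_trans (ltn_ord j); rewrite jE addnS.
    rewrite (IH (Ordinal lt)) //; apply: next; by rewrite jE addnS.
  case: (posnP N) => [N0|N0]; first by exists 0 => i; have := ltn_ord i; rewrite {2}N0.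
  exists (cQ (Ordinal N0)).1 => i; rewrite (all_eq i (Ordinal N0) i) //.
  by case: (hcQ i).
exists c; apply: (lead_coef_of_entries A2) => i j.
case: eqP => [->//|/eqP ij]; apply: has_symbol_ext (has_symbol0 _) => f.
by apply: entry_offdiag; rewrite eq_sym.
Qed.

End ScalarLeadCoef.


Import numFieldNormedType.Exports.

(** * Integrals over an open domain as limits over compact intervals *)

Section Exhaustion.
Local Open Scope classical_set_scope.
Context {R : realType}.
Local Notation mu := (@lebesgue_measure R).
Variables (D : set R) (a b : nat -> R).
Hypotheses (ab : forall n, a n < b n) (adec : forall n, a n.+1 <= a n)
  (binc : forall n, b n <= b n.+1) (DE : D = \bigcup_n `[a n, b n]%classic).
Implicit Types (f G : R -> R).

Lemma exhaust_mem n x : a n <= x <= b n -> D x.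
Proof. by move=> axb; rewrite DE; exists n => //=; rewrite in_itv. Qed.

Lemma exhaust_nondecreasing : nondecreasing_seq (fun n => `[a n, b n]).
Proof.
apply/nondecreasing_seqP => n; rewrite subsetEset => x /=; rewrite !in_itv /= => /andP[ax xb].
by rewrite (le_trans (adec n) ax) (le_trans xb (binc n)).
Qed.

Lemma exhaust_measurable : measurable D.
Proof. by rewrite DE; apply: bigcupT_measurable => n; exact: measurable_itv. Qed.

Lemma exhaust_within f n : (forall x, D x -> {for x, continuous f}) ->
  {within `[a n, b n], continuous f}.
Proof.
move=> cf; apply: continuous_in_subspaceT => x; rewrite inE /= in_itv /= => axb.
by apply: cf; apply: (exhaust_mem axb).
Qed.

Lemma exhaust_measurable_fun f : (forall x, D x -> {for x, continuous f}) -> measurable_fun D f.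
Proof.
move=> cf; rewrite DE; apply/measurable_fun_bigcup => [n|n]; first exact: measurable_itv.
by apply: subspace_continuous_measurable_fun; [exact: measurable_itv|exact: exhaust_within].
Qed.

Lemma exhaust_FTC f G n : (forall x, D x -> {for x, continuous f}) ->
  (forall x, D x -> is_derive x 1 G (f x)) ->
  (\int[mu]_(x in `[a n, b n]) (f x)%:E = (G (b n) - G (a n))%:E)%E.
Proof.
move=> cf dG; have cG x : a n <= x <= b n -> {for x, continuous G}.
  move=> /exhaust_mem Dx; apply: differentiable_continuous.
  by apply/derivable1_diffP; case: (dG x Dx).
rewrite (continuous_FTC2 (F := G)) ?EFinB //; first exact: exhaust_within.
- split.
  + move=> x; rewrite in_itv /= => /andP[/ltW ax /ltW xb].
    by have /dG[] : D x by apply: (@exhaust_mem n); rewrite ax.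
  + by apply: cvg_at_right_filter; apply: cG; rewrite lexx ltW.
  + by apply: cvg_at_left_filter; apply: cG; rewrite lexx ltW.
- move=> x; rewrite in_itv /= => /andP[/ltW ax /ltW xb].
  have /dG[_ <-] : D x by apply: (@exhaust_mem n); rewrite ax.
  by rewrite derive1E.
Qed.

(** Monotone convergence: on each compact interval the integral is a difference of two values of the
    bounded [G], hence at most [2 C]. *)
Lemma exhaust_integrable f G C : (forall x, D x -> {for x, continuous f}) ->
  (forall x, D x -> 0 <= f x) -> (forall x, D x -> is_derive x 1 G (f x)) ->
  (forall x, D x -> `|G x| <= C) -> mu.-integrable D (EFin \o f).
Proof.
move=> cf f0 dG GC; have mf := exhaust_measurable_fun cf.
apply/integrableP; split; first exact/measurable_EFinP.
have E : (\int[mu]_(x in D) `|(EFin \o f) x| = \int[mu]_(x in D) (f x)%:E)%E.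
  by apply: eq_integral => x /[!inE] Dx; rewrite /= ger0_norm // f0.
rewrite E DE; have H : (\int[mu]_(x in `[a n, b n]) (f x)%:E)%E @[n --> \oo] -->
    (\int[mu]_(x in \bigcup_n `[a n, b n]) (f x)%:E)%E.
  apply: ge0_nondecreasing_set_cvg_integral => [|n|n|n x].
  - exact: exhaust_nondecreasing.
  - exact: measurable_itv.
  - apply/measurable_EFinP; apply: subspace_continuous_measurable_fun; first exact: measurable_itv.
    exact: exhaust_within.
  - by rewrite /= in_itv lee_fin => /exhaust_mem/f0.
apply: (@le_lt_trans _ _ (C + C)%:E); last exact: ltry.
rewrite -(cvg_lim _ H) //; apply: lime_le; first exact: (cvgP _ H).
apply: nearW => n; rewrite (exhaust_FTC n cf dG) lee_fin.
have Da : D (a n) by apply: (@exhaust_mem n); rewrite lexx ltW.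
have Db : D (b n) by apply: (@exhaust_mem n); rewrite lexx ltW.
rewrite (le_trans (ler_norm _)) // (le_trans (ler_normB _ _)) //.
by apply: lerD; apply: GC.
Qed.

(** Dominated convergence with [|f|] itself as the bound; the integrals over the compact intervals
    are boundary values of [G]. *)
Lemma exhaust_integral0 f G : (forall x, D x -> {for x, continuous f}) ->
  mu.-integrable D (EFin \o f) -> (forall x, D x -> is_derive x 1 G (f x)) ->
  G (a n) @[n --> \oo] --> 0 -> G (b n) @[n --> \oo] --> 0 ->
  \int[mu]_(x in D) f x = 0.
Proof.
move=> cf fi dG Ga Gb; have mf := exhaust_measurable_fun cf.
pose fn n := (EFin \o f) \_ `[a n, b n].
have [] := @dominated_convergence _ (measurableTypeR R) R mu D exhaust_measurable fn (EFin \o f)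
  (fun x => `|(f x)%:E|%E).
- move=> n; apply/(measurable_restrict _ (measurable_itv _) exhaust_measurable).
  by apply/measurable_EFinP; apply: measurable_funS mf; [exact: exhaust_measurable|move=> x []].
- exact/measurable_EFinP.
- apply/aeW => x; rewrite [in X in X -> _]DE => -[N _ xN].
  apply: cvg_near_cst; exists N => // n /= Nn; rewrite /fn patchE mem_set //.
  by have := exhaust_nondecreasing Nn; rewrite subsetEset; apply.
- exact: integrable_abse fi.
- apply/aeW => x n Dx; rewrite /fn patchE; case: ifP => _ //.
  by rewrite abse0 abse_ge0.
move=> _ _ H; have E n : (\int[mu]_(x in D) fn n x)%E = (G (b n) - G (a n))%:E.
  rewrite -(exhaust_FTC n cf dG) -integral_mkcondr; congr integral.
  by apply: setIidr => x /=; rewrite in_itv => /exhaust_mem.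
have {}H : (G (b n) - G (a n))%:E @[n --> \oo] --> (\int[mu]_(x in D) (f x)%:E)%E.
  by move: H; under eq_fun do rewrite E.
have H0 : (G (b n) - G (a n))%:E @[n --> \oo] --> (0 : R)%:E.
  by apply: cvg_EFin; [exact: nearW|rewrite -[0](subrr 0); apply: cvgB].
by rewrite /Rintegral (cvg_unique _ H H0).
Qed.

End Exhaustion.


(** * From a weight function to its functional *)

Definition wfun (R : realType) (D : set R) (w : R -> R) (p : {poly R}) : R :=
  (\int[lebesgue_measure]_(x in D) (p.[x] * w x))%R.

(** What the algebra needs of a weight. Integrability is recorded so that the matrix integrand can
    be split into its scalar terms. *)
Definition good_weight (R : realType) (D : set R) (w : R -> R) (rho tau : {poly R}) :=
  [/\ posfun (wfun D w), pearson (wfun D w) rho tau, measurable D &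
   forall p, lebesgue_measure.-integrable D (EFin \o (fun x => p.[x] * w x))].

Section WeightFunctional.
Local Open Scope classical_set_scope.
Context {R : realType}.
Local Notation mu := (@lebesgue_measure R).
Variables (D : set R) (a b : nat -> R).
Hypotheses (ab : forall n, a n < b n) (adec : forall n, a n.+1 <= a n)
  (binc : forall n, b n <= b n.+1) (DE : D = \bigcup_n `[a n, b n]%classic).
Variables (w w' : R -> R) (rho tau : {poly R}).
Hypothesis w_gt0 : forall x, D x -> 0 < w x.
Hypothesis dw : forall x, D x -> is_derive x 1 w (w' x).
Hypothesis pearson_w : forall x, D x -> rho.[x] * w' x = (tau - rho^`()).[x] * w x.
(* [h] dominates every polynomial multiple of [w] and has the bounded antiderivative [H]. *)
Variables (H h : R -> R) (C : R).
Hypothesis dH : forall x, D x -> is_derive x 1 H (h x).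
Hypothesis h_ge0 : forall x, D x -> 0 <= h x.
Hypothesis ch : forall x, D x -> {for x, continuous h}.
Hypothesis HC : forall x, D x -> `|H x| <= C.
Hypothesis dom : forall p : {poly R}, exists K, forall x, D x -> `|p.[x] * w x| <= K * h x.
Hypothesis bnd_a : forall p : {poly R}, (rho * p).[a n] * w (a n) @[n --> \oo] --> 0.
Hypothesis bnd_b : forall p : {poly R}, (rho * p).[b n] * w (b n) @[n --> \oo] --> 0.

Let mem := exhaust_mem DE.

Lemma weight_continuous x : D x -> {for x, continuous w}.
Proof.
move=> Dx; apply: differentiable_continuous; apply/derivable1_diffP.
by case: (dw Dx).
Qed.

Lemma poly_weight_continuous (p : {poly R}) x : D x ->
  {for x, continuous (fun x => p.[x] * w x)}.
Proof.
by move=> Dx; apply: continuousM; [exact: continuous_horner|exact: weight_continuous].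
Qed.

Lemma poly_weight_integrable (p : {poly R}) : mu.-integrable D (EFin \o (fun x => p.[x] * w x)).
Proof.
have [K hK] := dom p.
have hi : mu.-integrable D (EFin \o h).
  exact: (exhaust_integrable ab adec binc DE ch h_ge0 dH HC).
have gi := @integrableZl _ (measurableTypeR R) R mu D (exhaust_measurable DE) K _ hi.
apply: (@le_integrable _ (measurableTypeR R) R mu D (exhaust_measurable DE) _ _ _ _ gi).
  apply/measurable_EFinP; apply: (exhaust_measurable_fun DE) => x.
  exact: poly_weight_continuous.
move=> x Dx /=; rewrite lee_fin (le_trans (hK x Dx)) //; exact: ler_norm.
Qed.

Lemma wfun_linear (c : R) f g : wfun D w (c *: f + g) = c * wfun D w f + wfun D w g.
Proof.
have mD := exhaust_measurable DE.
rewrite /wfun -RintegralZl //; last exact: poly_weight_integrable.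
rewrite -RintegralD //; last exact: poly_weight_integrable.
  by apply: eq_Rintegral => x _; rewrite /= !hornerE mulrDl.
exact: (@integrableZl _ (measurableTypeR R) R mu D mD c _ (poly_weight_integrable f)).
Qed.

Lemma wfun_pearson : pearson (wfun D w) rho tau.
Proof.
(* The integrand is the derivative of [rho q w], by the pointwise Pearson equation. *)
move=> q; pose G x := (rho * q).[x] * w x.
apply: (exhaust_integral0 ab adec binc DE (G := G)).
- by move=> x; apply: poly_weight_continuous.
- exact: poly_weight_integrable.
- move=> x Dx; have dwx := dw Dx.
  have -> : G = horner (rho * q) * w by [].
  apply: is_derive_eq.
  rewrite derivM !hornerE /GRing.scale /=; have := pearson_w Dx; rewrite !hornerE => E.
  transitivity (q.[x] * (rho.[x] * w' x) + w x * (rho^`().[x] * q.[x] + rho.[x] * q^`().[x])).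
    by ring.
  by rewrite E; ring.
- exact: bnd_a.
- exact: bnd_b.
Qed.

Lemma wfun_pos (f : {poly R}) : f != 0 -> 0 < wfun D w (f * f).
Proof.
move=> f0; have mD := exhaust_measurable DE.
have [y /andP[ay yb] fy] : exists2 y, a 0 < y < b 0 & f.[y] != 0.
  (* More points than [f] has roots; the denominators start at [2] to keep them strictly inside the
     interval. *)
  pose s := [seq a 0 + (b 0 - a 0) / i.+2%:R | i <- iota 0 (size f)].
  have /allPn[_ /mapP[i _ ->] pa] : ~~ all (root f) s.
    apply/negP => /(max_poly_roots f0); rewrite size_map size_iota ltnn => /(_ _)/notF; apply.
    rewrite map_inj_uniq ?iota_uniq // => i j /addrI/mulfI E.
    have : b 0 - a 0 != 0 by rewrite subr_eq0 gt_eqF.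
    by move=> /E/invr_inj/eqP; rewrite eqr_nat => /eqP[].
  exists (a 0 + (b 0 - a 0) / i.+2%:R) => //.
  have d0 : 0 < b 0 - a 0 by rewrite subr_gt0.
  rewrite ltrDl divr_gt0 //= -ltrBrDl ltr_pdivrMr // ltr_pMr // ltr1n //.
pose F x := (f * f).[x] * w x.
have Fy : 0 < F y.
  rewrite /F hornerM mulr_gt0 //; last by apply/w_gt0/(@mem 0); rewrite !ltW.
  by rewrite -expr2 lt_neqAle sqr_ge0 andbT eq_sym sqrf_eq0.
have Dy : D y by apply: (@mem 0); rewrite !ltW.
have F_ge0 x : D x -> 0 <= F x.
  move=> Dx; rewrite /F hornerM; apply: mulr_ge0; last exact/ltW/w_gt0.
  by rewrite -expr2 sqr_ge0.
have [e e0 he] : exists2 e : R, 0 < e & forall x, `|y - x| < e -> F y / 2 < F x.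
  have cF := poly_weight_continuous (p := f * f) Dy.
  have : \forall x \near y, F y / 2 < F x.
    by apply: (cvgr_gt (F y) cF); rewrite ltr_pdivrMr // ltr_pMr // ltr1n.
  by move=> /nbhs_ballP[e /= e0 he]; exists e => // x xe; apply: he.
(* The segment of length [d] starting at [y] lies in [D] and where the integrand exceeds [F y / 2],
   which bounds the integral below by [F y / 2 * d]. *)
pose d := Num.min (e / 2) (b 0 - y).
have d0 : 0 < d by rewrite lt_min divr_gt0 //= subr_gt0.
have sub : `[y, y + d] `<=` D.
  move=> x /=; rewrite in_itv /= => /andP[yx xyd]; apply: (@mem 0).
  rewrite (le_trans (ltW ay) yx) /= (le_trans xyd) // -lerBrDl /d ge_min lexx orbT //.
have cst : mu.-integrable `[y, y + d] (EFin \o (fun=> F y / 2)).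
  apply: continuous_compact_integrable; first exact: segment_compact.
  by apply: continuous_subspaceT => x; apply: cvg_cst.
have iF := poly_weight_integrable (f * f).
have iFs := @integrableS _ (measurableTypeR R) R mu _ _ _ mD (measurable_itv _) sub iF.
have L : lebesgue_measure (`[y, y + d]%classic : set R) = d%:E.
  by rewrite lebesgue_measure_itv /= lte_fin ltrDl d0 -EFinB addrAC subrr add0r.
have lb : F y / 2 * d <= \int[mu]_(x in `[y, y + d]) F x.
  have -> : F y / 2 * d = \int[mu]_(x in `[y, y + d]) (F y / 2).
    rewrite Rintegral_cst; last exact: measurable_itv.
    congr (_ * _); apply: (congr1 fine (esym L)).
  apply: (@le_Rintegral _ (measurableTypeR R) R mu _ _ _ (measurable_itv _) cst iFs) => x /=.
  rewrite in_itv /= => /andP[yx xyd]; apply/ltW/he.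
  rewrite ler0_norm ?subr_le0 // opprB ltrBlDl (le_lt_trans xyd) // ltrD2l.
  by rewrite /d gt_min ltr_pdivrMr // ltr_pMr // ltr1n.
apply: lt_le_trans (_ : F y / 2 * d <= _); first by rewrite mulr_gt0 // divr_gt0.
apply: le_trans lb _; rewrite /wfun /Rintegral; apply: fine_le.
- apply: integrable_fin_num; first exact: measurable_itv.
  exact: iFs.
- by apply: integrable_fin_num; [exact: mD|exact: iF].
- apply: ge0_subset_integral => //.
  by apply/measurable_EFinP; apply: (exhaust_measurable_fun DE) => x; apply: poly_weight_continuous.
Qed.

Lemma wfun_posfun : posfun (wfun D w).
Proof. by split; [exact: wfun_linear|exact: wfun_pos]. Qed.

Lemma dominated_good_weight : good_weight D w rho tau.
Proof.
split; [exact: wfun_posfun|exact: wfun_pearson|exact: exhaust_measurable DE|].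
exact: poly_weight_integrable.
Qed.

End WeightFunctional.


(** * Elementary bounds and endpoint sequences *)

Section WeightBounds.
Local Open Scope classical_set_scope.
Context {R : realType}.
Implicit Types (p q : {poly R}) (x y : R).

Lemma norm_horner_le p x y : 1 <= y -> `|x| <= y ->
  `|p.[x]| <= (\sum_(i < size p) `|p`_i|) * y ^+ size p.
Proof.
move=> y1 xy; rewrite horner_coef mulr_suml; apply: le_trans (ler_norm_sum _ _ _) _.
apply: ler_sum => i _; rewrite normrM normrX ler_wpM2l //.
apply: le_trans (_ : y ^+ i <= _); first by rewrite lerXn2r // nnegrE // (le_trans _ xy).
by rewrite ler_weXn2l // ltnW.
Qed.

Lemma exprn_le_expR n : exists2 K : R, 0 <= K & forall y, 0 <= y -> y ^+ n <= K * expR y.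
Proof.
case: n => [|n].
  by exists 1 => // y y0; rewrite mul1r expr0 -expR0 ler_expR.
exists (n.+1%:R ^+ n.+1) => [|y y0]; first by rewrite exprn_ge0.
(* With [n.+1] as the exponent, [expR y] is the matching power of [expR (y / n.+1)], and [y / n.+1]
   is below its exponential. *)
have -> : y = n.+1%:R * (y / n.+1%:R) by rewrite mulrC divfK // pnatr_eq0.
rewrite exprMn expRM_natl ler_wpM2l ?exprn_ge0 // lerXn2r // ?nnegrE ?expR_ge0 ?divr_ge0 //.
by apply: le_trans (expR_ge1Dx _); rewrite lerDr.
Qed.

Lemma norm_squeeze0 (f : nat -> R) K : (forall n, `|f n| <= K * n.+1%:R^-1) ->
  f n @[n --> \oo] --> 0.
Proof.
move=> h; have g0 : K * n.+1%:R^-1 @[n --> \oo] --> (0 : R).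
  by rewrite -[0](mulr0 K); apply: cvgMr; exact: cvg_harmonic.
apply: (@squeeze_cvgr _ _ _ _ (fun n => - (K * n.+1%:R^-1)) (fun n => K * n.+1%:R^-1)) => //.
  by apply: nearW => n; rewrite -ler_norml.
by rewrite -[0]oppr0; apply: cvgN.
Qed.

(** Chosen so that its power [c] is [1 / (n + 2)]: a boundary term of order [t ^ c] then decays like
    a harmonic sequence. The shift by two keeps it below [1]. *)
Definition eps (c : R) n : R := n.+2%:R^-1 `^ c^-1.

Lemma eps_gt0 c n : 0 < eps c n.
Proof. by rewrite powR_gt0 // invr_gt0. Qed.

Lemma eps_lt1 c n : 0 < c -> eps c n < 1.
Proof.
move=> c0; have E : (1 : R) `^ c^-1 = 1 by rewrite powR1.
rewrite -[ltRHS]E gt0_ltr_powR ?invr_gt0 // ?nnegrE ?invr_ge0 //.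
by rewrite invf_lt1 // ltr1n.
Qed.

Lemma eps_powR c n : 0 < c -> eps c n `^ c = n.+2%:R^-1.
Proof. by move=> c0; rewrite /eps -powRrM mulVf ?gt_eqF // powRr1 // invr_ge0. Qed.

Lemma eps_decr c n : 0 < c -> eps c n.+1 <= eps c n.
Proof.
move=> c0; apply: ge0_ler_powR; rewrite ?nnegrE ?invr_ge0 //; first exact: ltW.
by rewrite lef_pV2 ?posrE // ler_nat.
Qed.

Lemma eps_small c x : 0 < c -> 0 < x -> exists N, forall n, (N <= n)%N -> eps c n <= x.
Proof.
move=> c0 x0; have xc0 : 0 < x `^ c by rewrite powR_gt0.
exists (Num.bound (x `^ c)^-1) => n Nn.
rewrite -[x]powRr1; last exact: ltW.
rewrite -(divff (lt0r_neq0 c0)) powRrM.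
apply: ge0_ler_powR; rewrite ?nnegrE ?invr_ge0 //; [exact: ltW|exact: ltW|].
rewrite -[leRHS]invrK lef_pV2 ?posrE ?invr_gt0 //.
apply: le_trans (ltW (archi_boundP _)) _; first by rewrite invr_ge0 ltW.
by rewrite ler_nat (leq_trans Nn) // leqW.
Qed.

Lemma is_derive_continuous (f : R -> R) x (df : R) : is_derive x 1 f df -> {for x, continuous f}.
Proof. by move=> [fd _]; apply: differentiable_continuous; apply/derivable1_diffP. Qed.

Lemma is_derive_powR_horner q (r : R) x : 0 < q.[x] ->
  is_derive x 1 (fun x => q.[x] `^ r) (r * q.[x] `^ (r - 1) * q^`().[x]).
Proof.
move=> q0; have d := is_derive1_powR r q0.
have e := is_derive_poly q x.
exact: (@is_derive1_comp _ (fun y => y `^ r) (horner q) x _ _ d e).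
Qed.

End WeightBounds.


(** * The Hermite weight *)

Section Hermite.
Local Open Scope classical_set_scope.
Context {R : realType}.
Implicit Types (p : {poly R}) (x b : R).

(** The dominating function is the derivative of [atan], which is bounded. *)
Lemma hermite_dominated b p : exists K, forall x,
  `|p.[x] * w_hermite b x| <= K * (1 + x ^+ 2)^-1.
Proof.
have [K K0 hK] := @exprn_le_expR R (size p).+1.
pose S := \sum_(i < size p) `|p`_i|; have S0 : 0 <= S by apply: sumr_ge0.
exists (S * 2 ^+ (size p).+1 * (K * expR (2^-1 + 2 * b ^+ 2))) => x.
set y := 1 + x ^+ 2; have y1 : 1 <= y by rewrite lerDl sqr_ge0.
have y0 : 0 < y by apply: lt_le_trans y1.
have xy : `|x| <= y.
  have [x1|/ltW x1] := lerP `|x| 1; first exact: le_trans y1.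
  by rewrite /y -[x ^+ 2]real_normK ?num_real // expr2 (le_trans (ler_peMl _ x1)) // lerDr.
rewrite ler_pdivlMr // normrM [`|w_hermite b x|]ger0_norm ?expR_ge0 //.
have e1 : y ^+ (size p).+1 <= 2 ^+ (size p).+1 * (K * expR (y / 2)).
  have {1}-> : y = 2 * (y / 2) by rewrite mulrC divfK.
  by rewrite exprMn ler_wpM2l ?exprn_ge0 // hK // divr_ge0 // ltW.
(* Completing the square: the exponent on the left is [1/2 + 2 b^2] minus half of [(x - 2 b)^2]. *)
have e2 : expR (y / 2) * w_hermite b x <= expR (2^-1 + 2 * b ^+ 2).
  rewrite -expRD ler_expR /y -subr_ge0.
  rewrite (_ : _ - _ = 2^-1 * (x - 2 * b) ^+ 2); last by field.
  by rewrite mulr_ge0 // sqr_ge0.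
apply: (@le_trans _ _ (S * y ^+ (size p).+1 * w_hermite b x)).
  rewrite exprS mulrAC [y * _]mulrC mulrA ler_wpM2r ?expR_ge0 // ler_wpM2r ?(ltW y0) //.
  exact: norm_horner_le.
apply: (@le_trans _ _ (S * (2 ^+ (size p).+1 * (K * expR (y / 2))) * w_hermite b x)).
  by rewrite ler_wpM2r ?expR_ge0 // ler_wpM2l.
rewrite -!mulrA ler_wpM2l // ler_wpM2l ?exprn_ge0 // ler_wpM2l //.
Qed.

Lemma hermite_good_weight b :
  good_weight (@dom_hermite R) (w_hermite b) 1 (- (2 *: 'X) + (2 * b)%:P).
Proof.
have bnd p (t : nat -> R) : (forall n, n.+1%:R <= `|t n|) ->
    (1 * p).[t n] * w_hermite b (t n) @[n --> \oo] --> (0 : R).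
  move=> ht; have [K hK] := hermite_dominated b (1 * p).
  apply: (@norm_squeeze0 _ _ `|K|) => n; apply: le_trans (hK _) _.
  apply: (@le_trans _ _ (`|K| * (1 + t n ^+ 2)^-1)).
    by rewrite ler_wpM2r ?ler_norm // invr_ge0 addr_ge0 // sqr_ge0.
  rewrite ler_wpM2l // lef_pV2 ?posrE ?ltr_pwDl ?sqr_ge0 //.
  apply: le_trans (ht n) _; rewrite -[t n ^+ 2]real_normK ?num_real //.
  have t1 : 1 <= `|t n| by apply: le_trans (ht n); rewrite ler1n.
  by rewrite (le_trans (ler_peMl _ t1)) // -expr2 lerDr.
apply: (@dominated_good_weight _ setT (fun n => - n.+1%:R) (fun n => n.+1%:R) _ _ _ _ _
  (fun x => w_hermite b x * (- 2 * x + 2 * b)) _ _ _ _ _ atan (fun x => (1 + x ^+ 2)^-1) (pi / 2)).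
- by move=> n; rewrite gtrN.
- by move=> n; rewrite lerN2 ler_nat.
- by move=> n; rewrite ler_nat.
- apply/seteqP; split=> x //= _; exists (Num.bound `|x|) => //=.
  rewrite in_itv /= -ler_norml; apply: le_trans (ltW (archi_boundP (normr_ge0 x))) _.
  by rewrite ler_nat leqnSn.
- by move=> x _; apply: expR_gt0.
- move=> x _; pose q : {poly R} := - 'X ^+ 2 + (2 * b) *: 'X.
  have -> : w_hermite b = expR \o horner q.
    by apply/funext => y; rewrite /w_hermite /= !hornerE.
  apply: (is_derive_eq (is_derive1_comp (is_derive_expR _) (is_derive_poly q x))).
  rewrite /= /w_hermite /q derivD derivN derivXn derivZ derivX !hornerE; ring.
- move=> x _; rewrite hornerC derivC subr0 mul1r !hornerE; ring.
- by move=> x _; rewrite invr_ge0 addr_ge0 // sqr_ge0.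
- move=> x _; have -> : (fun x : R => (1 + x ^+ 2)^-1) = (fun x => (horner (1 + 'X ^+ 2) x)^-1).
    by apply/funext => y; rewrite !hornerE.
  apply: continuousV; last exact: continuous_horner.
  by rewrite !hornerE gt_eqF // ltr_pwDl // sqr_ge0.
- by move=> x _; rewrite ler_norml ltW ?atan_gtNpi2 //= ltW ?atan_ltpi2.
- by move=> p; have [K hK] := hermite_dominated b p; exists K => x _.
- by move=> p; apply: bnd => n; rewrite normrN ger0_norm.
- by move=> p; apply: bnd => n; rewrite ger0_norm.
Qed.

End Hermite.


(** * The Laguerre weight *)

Section Laguerre.
Local Open Scope classical_set_scope.
Context {R : realType}.
Implicit Types (p : {poly R}) (x al : R).

(** Up to the factor [al + 1], the dominating function is the derivative of
    [(x / (1 + x)) ^ (al + 1)], which lies between [0] and [1]; it has the singularity of the weight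
    at [0] and is integrable at infinity. *)
Lemma laguerre_dominated al p : -1 < al -> exists2 K, 0 <= K & forall x, 0 < x ->
  `|p.[x] * w_laguerre al x| <= K * (x `^ al * (1 + x) `^ (- al - 2)).
Proof.
move=> al1; pose M := Num.bound (al + 2); pose n := (size p + M)%N.
have al2 : 0 <= al + 2 by lra.
have [K K0 hK] := @exprn_le_expR R n.
pose S := \sum_(i < size p) `|p`_i|; have S0 : 0 <= S by apply: sumr_ge0.
exists (S * (K * expR 1)) => [|x x0]; first by rewrite !mulr_ge0 // expR_ge0.
set y := 1 + x; have y1 : 1 <= y by rewrite lerDl ltW.
have y0 : 0 < y by apply: lt_le_trans y1.
have xy : `|x| <= y by rewrite gtr0_norm // lerDr.
have yp : 0 < y `^ (al + 2) by apply: powR_gt0.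
have -> : - al - 2 = - (al + 2) by ring.
rewrite powRN [_ * (_ / _)]mulrA ler_pdivlMr // normrM [`|w_laguerre al x|]ger0_norm; last first.
  by rewrite mulr_ge0 ?expR_ge0 ?powR_ge0.
have e1 : y `^ (al + 2) <= y ^+ M.
  rewrite -powR_mulrn ?(ltW y0) //; apply: ler_powR => //; exact/ltW/archi_boundP.
have e2 : `|p.[x]| * y `^ (al + 2) <= S * (K * expR y).
  apply: (@le_trans _ _ (S * y ^+ size p * y ^+ M)).
    by apply: ler_pM => //; [exact: ltW|exact: norm_horner_le].
  by rewrite -mulrA -exprD ler_wpM2l // hK // ltW.
rewrite /w_laguerre; apply: (@le_trans _ _ (S * (K * expR y) * (expR (- x) * x `^ al))).
  by rewrite mulrAC ler_wpM2r // mulr_ge0 ?expR_ge0 ?powR_ge0.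
have -> : expR y = expR 1 * expR x by rewrite -expRD.
rewrite expRN le_eqVlt; apply/orP; left; apply/eqP.
by field; rewrite gt_eqF // expR_gt0.
Qed.

Lemma laguerre_good_weight al : -1 < al ->
  good_weight (@dom_laguerre R) (w_laguerre al) 'X ((al + 1)%:P - 'X).
Proof.
move=> al1; have c0 : 0 < al + 1 by lra.
have d1 x s : 0 < x -> is_derive x 1 (fun x : R => (1 + x) `^ s) (s * (1 + x) `^ (s - 1)).
  move=> x0; have := @is_derive_powR_horner _ (1 + 'X) s x; rewrite derivD derivX -polyC1 derivC.
  have -> : (fun x0 : R => (1%:P + 'X).[x0] `^ s) = (fun x0 => (1 + x0) `^ s).
    by apply/funext => z; rewrite !hornerE.
  by rewrite !hornerE; apply; apply: addr_gt0.
pose h x := (al + 1) * (x `^ al * (1 + x) `^ (- al - 2)).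
pose H x := x `^ (al + 1) * (1 + x) `^ (- al - 1).
have hH x : 0 < x -> H x = x * (1 + x) * (x `^ al * (1 + x) `^ (- al - 2)).
  move=> x0; have y0 : 0 < 1 + x by apply: addr_gt0.
  rewrite /H powRD; last by rewrite (gt_eqF x0) implybT.
  have -> : - al - 1 = 1 + (- al - 2) by ring.
  rewrite (@powRD _ (1 + x)); last by rewrite (gt_eqF y0) implybT.
  by rewrite !powRr1 ?(ltW x0) ?(ltW y0) //; ring.
have H1 x : 0 < x -> H x <= 1.
  move=> x0; have y0 : 0 < 1 + x by apply: addr_gt0.
  rewrite /H (_ : - al - 1 = - (al + 1)); last by ring.
  rewrite powRN ler_pdivrMr ?powR_gt0 // mul1r.
  by apply: ge0_ler_powR; rewrite ?nnegrE ?(ltW c0) ?(ltW x0) ?(ltW y0) // lerDr.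
have H0 x : 0 <= H x by rewrite /H mulr_ge0 ?powR_ge0.
apply: (@dominated_good_weight _ (@dom_laguerre R) (eps (al + 1)) (fun n => n.+2%:R) _ _ _ _ _
  (fun x => w_laguerre al x * (al / x - 1)) _ _ _ _ _ H h 1).
- by move=> n; rewrite (lt_le_trans (eps_lt1 _ _)) // ler1n.
- by move=> n; apply: eps_decr.
- by move=> n; rewrite ler_nat.
- rewrite /dom_laguerre; apply/seteqP; split=> x /=.
    move=> x0; have [N1 hN1] := eps_small c0 x0.
    exists (maxn N1 (Num.bound x)) => //=; rewrite in_itv /= hN1 ?leq_maxl //=.
    apply: le_trans (ltW (archi_boundP (ltW x0))) _.
    by rewrite ler_nat (leq_trans (leq_maxr N1 _)) // -addn2 leq_addr.
  by move=> [n _]; rewrite /= in_itv /= => /andP[/(lt_le_trans (eps_gt0 _ _))].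
- by move=> x x0; rewrite mulr_gt0 ?expR_gt0 ?powR_gt0.
- move=> x x0; have p1 := is_derive1_powR al x0.
  have e1 : is_derive x 1 (fun x => expR (- x)) (- expR (- x)).
    apply: (is_derive_eq (is_derive1_comp (is_derive_expR _) (is_deriveNid _ _))).
    by rewrite mulrN1.
  apply: (is_derive_eq (is_deriveM e1 p1)).
  rewrite /GRing.scale /= /w_laguerre powRB; last by rewrite (gt_eqF x0) implybT.
  rewrite powRr1 ?(ltW x0) //; move: (expR (- x)) (x `^ al) => E P.
  by rewrite mulrN mulrBr mulr1 [P * E]mulrC -!mulrA; congr (_ * _ - _); exact: mulrCA.
- move=> x x0; rewrite derivX !hornerE /=; field; by rewrite gt_eqF.
- move=> x x0; have p1 := is_derive1_powR (al + 1) x0.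
  apply: (is_derive_eq (is_deriveM p1 (d1 x (- al - 1) x0))).
  have y0 : 0 < 1 + x by apply: addr_gt0.
  have -> : - al - 1 - 1 = - al - 2 :> R by ring.
  have E1 : x `^ (al + 1) = x * x `^ al by rewrite -mulr_powRB1 ?addrK // ltW.
  have E2 : (1 + x) `^ (- al - 1) = (1 + x) * (1 + x) `^ (- al - 2).
    have -> : - al - 1 = 1 + (- al - 2) by ring.
    by rewrite powRD ?powRr1 ?(ltW y0) // (gt_eqF y0) implybT.
  rewrite /GRing.scale /= /h addrK E1 E2.
  move: (x `^ al) ((1 + x) `^ (- al - 2)) => P Q; ring.
- move=> x x0; rewrite /h; apply: mulr_ge0; first exact: ltW.
  by rewrite mulr_ge0 ?powR_ge0.
- move=> x x0; apply: continuousM; first exact: cvg_cst.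
  apply: continuousM; first exact: is_derive_continuous (is_derive1_powR al x0).
  exact: is_derive_continuous (d1 x (- al - 2) x0).
- by move=> x x0; rewrite ger0_norm // H1.
- move=> p; have [K K0 hK] := laguerre_dominated p al1.
  exists (K / (al + 1)) => x x0; rewrite /h mulrA divfK ?gt_eqF //; exact: hK.
(* Near [0] the factor [rho = x] raises the exponent to [al + 1], so the power equals [1 / (n + 2)]
   along [eps (al + 1)]. *)
- move=> p; apply: (@norm_squeeze0 _ _ (\sum_(i < size p) `|p`_i|)) => n.
  set t := eps (al + 1) n; have t0 : 0 < t := eps_gt0 _ _.
  have -> : ('X * p).[t] * w_laguerre al t = p.[t] * (expR (- t) * t `^ (al + 1)).
    rewrite hornerM hornerX /w_laguerre -(@mulr_powRB1 _ t (al + 1)) ?addrK ?(ltW t0) //; ring.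
  rewrite normrM [`|expR _ * _|]ger0_norm ?mulr_ge0 ?expR_ge0 ?powR_ge0 // eps_powR //.
  apply: ler_pM => //.
    have := @norm_horner_le _ p t 1 (lexx _); rewrite expr1n mulr1; apply.
    by rewrite gtr0_norm // ltW // eps_lt1.
  rewrite -[leRHS]mul1r; apply: ler_pM; rewrite ?expR_ge0 ?invr_ge0 //.
    by rewrite expR_le1 oppr_le0 ltW.
  by rewrite lef_pV2 ?posrE // ler_nat.
(* At infinity the domination is reused: [H <= 1] bounds the dominating power by
   [1 / (t (1 + t))]. *)
- move=> p; have [K K0 hK] := laguerre_dominated ('X * p) al1.
  apply: (@norm_squeeze0 _ _ K) => n; have t0 : 0 < n.+2%:R :> R by [].
  move: (hK _ t0) (H1 _ t0); rewrite (hH _ t0); set t : R := n.+2%:R; set P := _ `^ _ * _.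
  move=> hP H1P; apply: le_trans hP _; rewrite ler_wpM2l //.
  have tt : 0 < t * (1 + t) by rewrite mulr_gt0 // addr_gt0.
  apply: (@le_trans _ _ (t * (1 + t))^-1); first by rewrite -[leRHS]mul1r ler_pdivlMr // mulrC.
  rewrite lef_pV2 ?posrE //; apply: (@le_trans _ _ t); first by rewrite ler_nat.
  by rewrite ler_peMr ?(ltW t0) // lerDl ltW.
Qed.

End Laguerre.


(** * The Jacobi weight *)

Section Jacobi.
Local Open Scope classical_set_scope.
Context {R : realType}.
Implicit Types (p : {poly R}) (x al be : R).

Lemma powR_le2 x s : 1 <= x <= 2 -> x `^ s <= 2 `^ `|s|.
Proof.
move=> /andP[x1 x2]; apply: (@le_trans _ _ (x `^ `|s|)); first by rewrite ler_powR // ler_norm.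
by apply: ge0_ler_powR; rewrite ?nnegrE // (le_trans _ x1).
Qed.

Lemma is_derive_powR_1D x s : -1 < x ->
  is_derive x 1 (fun x : R => (1 + x) `^ s) (s * (1 + x) `^ (s - 1)).
Proof.
move=> x0; have := @is_derive_powR_horner _ (1 + 'X) s x; rewrite derivD derivX -polyC1 derivC.
have -> : (fun x0 : R => (1%:P + 'X).[x0] `^ s) = (fun x0 => (1 + x0) `^ s).
  by apply/funext => z; rewrite !hornerE.
by rewrite !hornerE; apply; rewrite -ltrBlDl sub0r.
Qed.

Lemma is_derive_powR_1B x s : x < 1 ->
  is_derive x 1 (fun x : R => (1 - x) `^ s) (- (s * (1 - x) `^ (s - 1))).
Proof.
move=> x0; have := @is_derive_powR_horner _ (1 - 'X) s x; rewrite derivB derivX -polyC1 derivC.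
have -> : (fun x0 : R => (1%:P - 'X).[x0] `^ s) = (fun x0 => (1 - x0) `^ s).
  by apply/funext => z; rewrite !hornerE.
by rewrite sub0r !hornerE mulrN1; apply; rewrite subr_gt0.
Qed.

(** On each half of the interval one of the bases lies between [1] and [2], so that factor is
    bounded. A sum of two powers then dominates, and it has an explicit bounded antiderivative. *)
Lemma jacobi_dominated al be p : exists K, forall x, -1 < x < 1 ->
  `|p.[x] * w_jacobi al be x| <= K * ((1 + x) `^ be + (1 - x) `^ al).
Proof.
pose S := \sum_(i < size p) `|p`_i|; have S0 : 0 <= S by apply: sumr_ge0.
exists (S * (2 `^ `|be| + 2 `^ `|al|)) => x /andP[xl xu].
have pS : `|p.[x]| <= S.
  have := @norm_horner_le _ p x 1 (lexx _); rewrite expr1n mulr1; apply.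
  by rewrite ler_norml !ltW.
rewrite normrM [`|w_jacobi _ _ x|]ger0_norm ?mulr_ge0 ?powR_ge0 // -[leRHS]mulrA.
apply: ler_pM => //; first by rewrite mulr_ge0 ?powR_ge0.
rewrite /w_jacobi; set P := (1 - x) `^ al; set Q := (1 + x) `^ be.
have P0 : 0 <= P := powR_ge0 _ _; have Q0 : 0 <= Q := powR_ge0 _ _.
have c1 : 0 <= (2 : R) `^ `|be| := powR_ge0 _ _; have c2 : 0 <= (2 : R) `^ `|al| := powR_ge0 _ _.
have [x0|/ltW x0] := lerP 0 x.
  have QB : Q <= 2 `^ `|be| by apply: powR_le2; apply/andP; split; lra.
  have : P * Q <= P * 2 `^ `|be| by rewrite ler_wpM2l.
  nra.
have PB : P <= 2 `^ `|al| by apply: powR_le2; apply/andP; split; lra.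
have : P * Q <= 2 `^ `|al| * Q by rewrite ler_wpM2r.
nra.
Qed.

Lemma jacobi_good_weight al be : -1 < al -> -1 < be ->
  good_weight (@dom_jacobi R) (w_jacobi al be) (1 - 'X ^+ 2)
    ((be - al)%:P - (al + be + 2) *: 'X).
Proof.
move=> al1 be1; have ca : 0 < al + 1 by lra. have cb : 0 < be + 1 by lra.
pose h x := (1 + x) `^ be + (1 - x) `^ al.
pose H x := (be + 1)^-1 * (1 + x) `^ (be + 1) - (al + 1)^-1 * (1 - x) `^ (al + 1).
have ea n := eps_gt0 (al + 1) n; have eb n := eps_gt0 (be + 1) n.
have ea1 n := eps_lt1 n ca; have eb1 n := eps_lt1 n cb.
have bnd p (t : nat -> R) C : (forall n, -1 < t n < 1) ->
    (forall n, (1 - t n) `^ (al + 1) * (1 + t n) `^ (be + 1) <= C * n.+1%:R^-1) ->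
    ((1 - 'X ^+ 2) * p).[t n] * w_jacobi al be (t n) @[n --> \oo] --> 0.
  move=> t1 tC; apply: (@norm_squeeze0 _ _ ((\sum_(i < size p) `|p`_i|) * C)) => n.
  have /andP[tl tu] := t1 n.
  have u0 : 0 <= 1 - t n by lra.
  have v0 : 0 <= 1 + t n by lra.
  have -> : ((1 - 'X ^+ 2) * p).[t n] * w_jacobi al be (t n) =
      p.[t n] * ((1 - t n) `^ (al + 1) * (1 + t n) `^ (be + 1)).
    rewrite -(@mulr_powRB1 _ (1 - t n) (al + 1)) // -(@mulr_powRB1 _ (1 + t n) (be + 1)) //.
    by rewrite !addrK /w_jacobi !hornerE /=; ring.
  rewrite normrM -mulrA; apply: ler_pM => //; last by rewrite ger0_norm ?mulr_ge0 ?powR_ge0.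
  have := @norm_horner_le _ p (t n) 1 (lexx _); rewrite expr1n mulr1; apply.
  by rewrite ler_norml !ltW.
(* Each endpoint is approached at the rate fixed by its own exponent, [be + 1] at [-1] and [al + 1]
   at [1]. *)
apply: (@dominated_good_weight _ (@dom_jacobi R) (fun n => -1 + eps (be + 1) n)
  (fun n => 1 - eps (al + 1) n) _ _ _ _ _
  (fun x => w_jacobi al be x * (be / (1 + x) - al / (1 - x))) _ _ _ _ _ H h
  ((be + 1)^-1 * 2 `^ (be + 1) + (al + 1)^-1 * 2 `^ (al + 1))).
- by move=> n; have := ea1 n; have := eb1 n; lra.
- by move=> n; have := eps_decr n cb; lra.
- by move=> n; have := eps_decr n ca; lra.
- rewrite /dom_jacobi; apply/seteqP; split=> x /=.
    move=> /andP[xl xu].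
    have [N1 h1] := @eps_small _ (be + 1) (1 + x) cb ltac:(by lra).
    have [N2 h2] := @eps_small _ (al + 1) (1 - x) ca ltac:(by lra).
    exists (maxn N1 N2) => //=; rewrite in_itv /=.
    have := h1 _ (leq_maxl N1 N2); have := h2 _ (leq_maxr N1 N2).
    by move=> *; apply/andP; split; lra.
  move=> [n _]; rewrite /= in_itv /= => /andP[xl xu].
  by have := ea n; have := eb n; move=> *; apply/andP; split; lra.
- by move=> x /andP[xl xu]; rewrite mulr_gt0 // powR_gt0 //; lra.
- move=> x /andP[xl xu].
  have u0 : 0 < 1 - x by lra. have v0 : 0 < 1 + x by lra.
  apply: (is_derive_eq (is_deriveM (is_derive_powR_1B al xu) (is_derive_powR_1D be xl))).
  rewrite /GRing.scale /= /w_jacobi !powRB ?(gt_eqF u0) ?(gt_eqF v0) ?implybT //.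
  rewrite !powRr1 ?(ltW u0) ?(ltW v0) //.
  move: ((1 - x) `^ al) ((1 + x) `^ be) => P Q; field.
  by rewrite !gt_eqF.
- move=> x /andP[xl xu]; rewrite derivB derivXn -polyC1 derivC !hornerE /=; field.
  by rewrite !gt_eqF //; lra.
- move=> x /andP[xl xu].
  have := is_deriveB (is_deriveZ (be + 1)^-1 (is_derive_powR_1D (be + 1) xl))
    (is_deriveZ (al + 1)^-1 (is_derive_powR_1B (al + 1) xu)).
  move/is_derive_eq; apply; rewrite /GRing.scale /= !addrK /h.
  by field; rewrite !gt_eqF.
- by move=> x _; rewrite /h addr_ge0 ?powR_ge0.
- move=> x /andP[xl xu]; apply: continuousD.
    exact: is_derive_continuous (is_derive_powR_1D be xl).
  exact: is_derive_continuous (is_derive_powR_1B al xu).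
- move=> x /andP[xl xu]; apply: le_trans (ler_normB _ _) _.
  rewrite !ger0_norm ?mulr_ge0 ?powR_ge0 ?invr_ge0 ?(ltW ca) ?(ltW cb) //.
  apply: lerD; rewrite ler_wpM2l ?invr_ge0 ?(ltW ca) ?(ltW cb) //;
    by apply: ge0_ler_powR; rewrite ?nnegrE //; lra.
- by move=> p; have [K hK] := jacobi_dominated al be p; exists K => x Dx; apply: hK.
- move=> p; apply: (bnd p (fun n => -1 + eps (be + 1) n) (2 `^ (al + 1))) => n.
    by have := eb n; have := eb1 n; move=> *; apply/andP; split; lra.
  have -> : 1 + (-1 + eps (be + 1) n) = eps (be + 1) n by ring.
  rewrite eps_powR // ler_pM ?powR_ge0 ?invr_ge0 //; last by rewrite lef_pV2 ?posrE // ler_nat.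
  have := eb n; have := eb1 n; move=> *.
  by apply: ge0_ler_powR; rewrite ?nnegrE //; lra.
- move=> p; apply: (bnd p (fun n => 1 - eps (al + 1) n) (2 `^ (be + 1))) => n.
    by have := ea n; have := ea1 n; move=> *; apply/andP; split; lra.
  have -> : 1 - (1 - eps (al + 1) n) = eps (al + 1) n by ring.
  rewrite eps_powR // mulrC ler_pM ?powR_ge0 ?invr_ge0 //; last by rewrite lef_pV2 ?posrE // ler_nat.
  have := ea n; have := ea1 n; move=> *.
  by apply: ge0_ler_powR; rewrite ?nnegrE //; lra.
Qed.

End Jacobi.


(** * From the matrix weight to the scalar functionals *)

Section Reduction.
Local Open Scope classical_set_scope.
Local Open Scope ring_scope.
Context {R : realType} {N : nat}.
Local Notation vrow := {ffun 'I_N -> {poly R}}.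

(** With indices from [0], nonzero entries go from an even row to an odd column, so two of them
    never compose. *)
Lemma Amat_parity (a : nat -> R) (i j : 'I_N) : Amat N a i j != 0 -> ~~ odd i && odd j.
Proof.
rewrite mxE; case: ifP => [/andP[/eqP-> io] _|_]; first by rewrite /= io.
by case: ifP => [/andP[/eqP-> jo] _|]; rewrite ?eqxx //= jo.
Qed.

Lemma Amat_sqr0 (a : nat -> R) (i j k : 'I_N) : Amat N a i j * Amat N a j k = 0.
Proof.
apply/eqP; rewrite mulf_eq0; have [//|/Amat_parity/andP[_ jo]] := eqVneq (Amat N a i j) 0.
by apply/negPn/negP => /Amat_parity; rewrite jo.
Qed.

Lemma Amat_conn (a : nat -> R) : (forall s : nat, (1 <= s <= N.-1)%N -> a s != 0) ->
  forall i j : 'I_N, (j : nat) = i.+1 -> Amat N a i j != 0 \/ Amat N a j i != 0.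
Proof.
move=> a0 i j ij; have ai : a i.+1 != 0.
  by apply: a0; have := ltn_ord j; rewrite ij; lia.
rewrite !mxE ij eqxx /=; have [io|ie] := boolP (odd i); [right|by left].
by rewrite (_ : (i == i.+2 :> nat) = false) //; lia.
Qed.

Section Weights.
Variables (a : nat -> R) (D : set R) (w : 'I_N -> R -> R) (rho : {poly R}) (tau : 'I_N -> {poly R}).
Hypothesis gw : forall k, good_weight D (w k) rho (tau k).
Local Notation mu := (@lebesgue_measure R).
Local Notation A := (Amat N a).
Local Notation u := (fun k => wfun D (w k)).

Definition mxrow (P : 'M[{poly R}]_N) i : vrow := [ffun k => P i k].

Lemma Rintegral_weight_sum (s : seq 'I_N) (q : 'I_N -> {poly R}) : measurable D ->
  mu.-integrable D (EFin \o (fun x => \sum_(k <- s) (q k).[x] * w k x)) /\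
  \int[mu]_(x in D) (\sum_(k <- s) (q k).[x] * w k x) = \sum_(k <- s) u k (q k).
Proof.
move=> mD; elim: s => [|k s [IHi IHe]].
  have E : (fun x => \sum_(k <- [::]) (q k).[x] * w k x) = (fun=> 0).
    by apply/funext => x; rewrite big_nil.
  rewrite E big_nil; split; first exact: integrable0.
  by rewrite /Rintegral integral0.
have E : (fun x => \sum_(j <- k :: s) (q j).[x] * w j x) =
    (fun x => (q k).[x] * w k x + \sum_(j <- s) (q j).[x] * w j x).
  by apply/funext => x; rewrite big_cons.
have [_ _ _ int] := gw k.
rewrite E big_cons -IHe; split; last by rewrite RintegralD.
exact: (@integrableD _ (measurableTypeR R) R mu D mD _ _ (int (q k)) IHi).
Qed.

(** The factors [T] of the weight are absorbed into [P] and [Q], leaving a diagonal integrand. *)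
Lemma mx_ip_form (P Q : 'M[{poly R}]_N) i j :
  mx_ip D (Wmat a w) P Q i j = form A u (mxrow P i) (mxrow Q j).
Proof.
have ev (P' : 'M[{poly R}]_N) x i' k : (mxeval P' x *m Tmat N a x) i' k = (mulT A 1 (mxrow P' i') k).[x].
  rewrite /Tmat mulmxDr mulmx1 -scalemxAr !mxE !ffunE scale1r !hornerE; congr (_ + _ * _).
  rewrite horner_sum; apply: eq_bigr => l _; rewrite !ffunE !mxE hornerZ mulrC //.
rewrite mxE /form.
have mD : measurable D by have [] := gw i.
pose q k := mulT A 1 (mxrow P i) k * mulT A 1 (mxrow Q j) k.
rewrite -(Rintegral_weight_sum (index_enum 'I_N) q mD).2; apply: eq_Rintegral => x _.
have -> : mxeval P x *m Wmat a w x *m (mxeval Q x)^T =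
    (mxeval P x *m Tmat N a x) *m diag_mx (\row_k w k x) *m (mxeval Q x *m Tmat N a x)^T.
  by rewrite /Wmat trmx_mul !mulmxA.
rewrite [LHS]mxE; apply: eq_bigr => k _.
rewrite mul_mx_diag [X in X * _]mxE [X in _ * X]mxE [(\row_k0 _) _ _]mxE !ev /q hornerM.
by rewrite mulrAC.
Qed.

Lemma monic_orthogonal_mx P : monic_orthogonal A u P ->
  monic_OP_seq D (Wmat a w) (fun n => \matrix_(i, j) P n i j).
Proof.
have rowP n i : mxrow (\matrix_(i, j) P n i j) i = P n i.
  by apply/ffunP => k; rewrite ffunE mxE.
move=> [Pm Po]; split=> [n i j|n m nm]; first by rewrite mxE; apply: Pm.
by apply/matrixP => i j; rewrite mx_ip_form !rowP Po // mxE.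
Qed.

Section RealPart.
Variables (Pi : R[i] -> R).
Hypotheses (PiD : forall x y, Pi (x + y) = Pi x + Pi y) (PiC : forall r x, Pi ((r%:C)%C * x) = r * Pi x).

(** [Pi] stands for the real or the imaginary part; both are linear over the reals, and the
    orthogonal polynomials are real. *)
Definition part (q : {poly R[i]}) : {poly R} := map_poly Pi q.

Lemma Pi0 : Pi 0 = 0.
Proof. by have := PiC 0 0; rewrite mulr0 mul0r. Qed.

Lemma Pi_sum (I : Type) (s : seq I) (G : I -> R[i]) : Pi (\sum_(i <- s) G i) = \sum_(i <- s) Pi (G i).
Proof. exact: (big_morph Pi PiD Pi0). Qed.

Lemma coef_part q n : (part q)`_n = Pi q`_n.
Proof. by rewrite /part coef_map_id0 // Pi0. Qed.

Lemma part_sum (I : Type) (s : seq I) (G : I -> {poly R[i]}) :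
  part (\sum_(i <- s) G i) = \sum_(i <- s) part (G i).
Proof.
apply/polyP => n; rewrite coef_part !coef_sum Pi_sum; apply: eq_bigr => i _.
by rewrite coef_part.
Qed.

Lemma part_mul (p : {poly R}) q : part (map_poly (fun r : R => (r%:C)%C) p * q) = p * part q.
Proof.
apply/polyP => n; rewrite coef_part !coefM Pi_sum; apply: eq_bigr => i _.
by rewrite coef_map_id0 // PiC coef_part.
Qed.

Lemma part_mulC (c : R[i]) (p : {poly R}) :
  part (c%:P * map_poly (fun r : R => (r%:C)%C) p) = Pi c *: p.
Proof.
apply/polyP => n; rewrite coef_part coefCM coefZ coef_map_id0 //.
by rewrite mulrC PiC mulrC.
Qed.

Variables (m : nat) (F : nat -> 'M[{poly R[i]}]_N).
Hypothesis FD : in_DW D (Wmat a w) (2 * m) F.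

(** Applying [Pi] to the eigenvalue equation gives a real one, with coefficients [part (F l)] and
    eigenvalue matrix [Pi (Lam i j)]. *)
Lemma part_eig P : monic_orthogonal A u P -> forall n i, exists L : 'I_N -> R,
  act (2 * m) (fun l => map_mx part (F l)) (P n i) = \sum_j L j *: P n j.
Proof.
move=> oP n i; have [Lam E] := FD (monic_orthogonal_mx oP) n.
exists (fun j => Pi (Lam i j)); apply/ffunP => k; rewrite ffunE sum_ffunE.
move/matrixP: E => /(_ i k)/(congr1 part).
rewrite /op_act summxE part_sum [X in part X]mxE part_sum.
have -> : \sum_(l < (2 * m).+1) part ((map_mx (fun p => p^`(l))
    (cplx_mxpoly (\matrix_(i, j) P n i j)) *m F l) i k) =
    \sum_(l < (2 * m).+1) \sum_s (P n i s)^`(l) * part (F l s k).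
  apply: eq_bigr => l _; rewrite mxE part_sum; apply: eq_bigr => s _.
  rewrite !mxE (_ : (map_poly _ (P n i s))^`(l) = map_poly (real_complex R) (P n i s)^`(l)).
    exact: part_mul.
  exact: (derivn_map (real_complex R)).
rewrite exchange_big /=.
have -> : \sum_s \sum_(l < (2 * m).+1) (P n i s)^`(l) * part (F l s k) =
    \sum_s dop (2 * m) (fun l => map_mx part (F l) s k) (P n i s).
  by apply: eq_bigr => s _; apply: eq_bigr => l _; rewrite mxE.
move=> ->; apply: eq_bigr => s _; rewrite !mxE ffunE; exact: part_mulC.
Qed.

End RealPart.

Hypotheses (r0 : rho != 0) (rig : forall i j, i != j -> wronskian_rigid rho (tau i - tau j)).
Hypothesis a0 : forall s : nat, (1 <= s <= N.-1)%N -> a s != 0.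
Variables (m : nat) (F : nat -> 'M[{poly R[i]}]_N) (theta : R) (k : nat).
Hypothesis FD : in_DW D (Wmat a w) (2 * m) F.
Hypothesis th0 : theta != 0.
Hypothesis spec : forall i e, adjointable (u i) (dop (2 * m) e) ->
  symbol_spec theta k rho m (dop (2 * m) e) e.

Lemma leading_coef_of_spec : leading_coef_form F m (map_poly (real_complex R) rho).
Proof.
have up i : posfun (u i) by case: (gw i).
have pe i : pearson (u i) rho (tau i) by case: (gw i).
(* The real result is applied to both parts; the two constants become the real and imaginary parts
   of [c]. *)
have key Pi (PiD : forall x y, Pi (x + y) = Pi x + Pi y) (PiC : forall r x, Pi ((r%:C)%C * x) = r * Pi x) :=
  lead_coef_scalar (Amat_sqr0 a) up r0 pe rig (part_eig PiD PiC FD) th0 spec (Amat_conn a0).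
have [c1 h1] := key (@complex.Re R) (fun x y => ltac:(by case: x; case: y))
  (fun r x => ltac:(by case: x => x1 x2 /=; rewrite mul0r subr0)).
have [c2 h2] := key (@complex.Im R) (fun x y => ltac:(by case: x; case: y))
  (fun r x => ltac:(by case: x => x1 x2 /=; rewrite mul0r addr0)).
exists (c1 +i* c2)%C; apply/matrixP => i j; apply/polyP => n.
move/matrixP: h1 => /(_ i j)/polyP/(_ n); move/matrixP: h2 => /(_ i j)/polyP/(_ n).
rewrite !mxE !coef_part; last 2 first.
- by move=> r [x1 x2] /=; rewrite mul0r subr0.
- by move=> r [x1 x2] /=; rewrite mul0r addr0.
rewrite -rmorphXn !coefMn !coefZ coef_map /=; case: ((F _ _ _)`_n) => x y /= -> ->.
case: (i == j); last by rewrite !mulr0n.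
by rewrite !mulr1n; apply/eqP; rewrite eq_complex /= !mulr0 subr0 add0r !eqxx.
Qed.

End Weights.
End Reduction.


Lemma not_int_sub_nat (R : numDomainType) (r : R) (k l : nat) : not_int r -> k%:R - l%:R <> r.
Proof. by move=> /(_ (k%:Z - l%:Z)) h E; apply: h; rewrite -E rmorphB /= -!pmulrn. Qed.

Lemma size_linear (R : nzRingType) (c d : R) : (size (c%:P + d *: 'X)%R <= 2)%N.
Proof.
apply: leq_trans (size_polyD _ _) _; rewrite geq_max (leq_trans (size_polyC_leq1 _)) //=.
by apply: leq_trans (size_scale_leq _ _) _; rewrite size_polyX.
Qed.

Theorem theorem3p10 :
  (* Hermite case: W = W_H, rho = 1 *)
  (forall (R : realType) (N : nat), (2 <= N)%N ->
   forall a : nat -> R, (forall s : nat, (1 <= s <= N.-1)%N -> a s != 0) ->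
   forall b : 'I_N -> R, injective b ->
   forall (m : nat) (F : nat -> 'M[{poly R[i]}]_N),
     F (2 * m)%N != 0 ->
     in_DW (@dom_hermite R) (Wmat a (fun k => w_hermite (b k))) (2 * m) F ->
     leading_coef_form F m 1)
  /\
  (* Laguerre case: W = W_L, rho = x *)
  (forall (R : realType) (N : nat), (2 <= N)%N ->
   forall a : nat -> R, (forall s : nat, (1 <= s <= N.-1)%N -> a s != 0) ->
   forall al : 'I_N -> R, (forall k, -1 < al k) ->
   (forall k l : 'I_N, k != l -> not_int (al k - al l)) ->
   forall (m : nat) (F : nat -> 'M[{poly R[i]}]_N),
     F (2 * m)%N != 0 ->
     in_DW (@dom_laguerre R) (Wmat a (fun k => w_laguerre (al k))) (2 * m) F ->
     leading_coef_form F m 'X)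
  /\
  (* Jacobi case: W = W_J, rho = 1 - x^2 *)
  (forall (R : realType) (N : nat), (2 <= N)%N ->
   forall a : nat -> R, (forall s : nat, (1 <= s <= N.-1)%N -> a s != 0) ->
   forall al be : 'I_N -> R, (forall k, -1 < al k) -> (forall k, -1 < be k) ->
   (forall k l : 'I_N, k != l -> not_int (al k - al l) \/ not_int (be k - be l)) ->
   (* alpha_1 + beta_1 = alpha_j + beta_j + 1 + (-1)^j  (1-based j = l+1) *)
   (forall k l : 'I_N, (k : nat) = 0%N ->
      al k + be k = al l + be l + 1 + (-1) ^+ (l.+1)) ->
   forall (m : nat) (F : nat -> 'M[{poly R[i]}]_N),
     F (2 * m)%N != 0 ->
     in_DW (@dom_jacobi R) (Wmat a (fun k => w_jacobi (al k) (be k))) (2 * m) F ->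
     leading_coef_form F m (1 - 'X ^+ 2)).
Proof.
split; [|split].
- move=> R N _ a a0 b bi m F _ FD.
  pose tau i : {poly R} := - (2 *: 'X) + (2 * b i)%:P.
  have gw i : good_weight (@dom_hermite R) (w_hermite (b i)) 1 (tau i) := hermite_good_weight (b i).
  have n2 : (-2 : R) != 0 by rewrite oppr_eq0 pnatr_eq0.
  have stau i : (size (tau i) <= 2)%N by rewrite /tau addrC -scaleNr size_linear.
  rewrite -(rmorph1 (map_poly (real_complex R))).
  (* [delta] has eigenvalues [-2 n], hence [kappa = -2] and [theta = (-2) ^ m]. *)
  apply: (leading_coef_of_spec gw (oner_neq0 _) _ a0 FD (expf_neq0 m n2) (k := m)).
    move=> i j ij; have -> : tau i - tau j = (2 * (b i - b j))%:P.
      by rewrite /tau opprD addrACA subrr add0r -polyCB mulrBr.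
    apply: wronskian_rigid_const; rewrite mulf_neq0 ?pnatr_eq0 // subr_eq0.
    by apply: contra ij => /eqP/bi->.
  move=> i e ae; have [up pe _ _] := gw i.
  apply: (symbol_spec_linear up pe _ (stau i) (oner_neq0 _) ae n2).
  + by rewrite size_poly1.
  + by rewrite coef1.
  + by rewrite /tau coefD coefN coefZ coefX coefC mulr1 addr0.
- move=> R N _ a a0 al al1 ali m F _ FD.
  pose tau i : {poly R} := (al i + 1)%:P - 'X.
  have gw i : good_weight (@dom_laguerre R) (w_laguerre (al i)) 'X (tau i) :=
    laguerre_good_weight (al1 i).
  have n1 : (-1 : R) != 0 by rewrite oppr_eq0 oner_eq0.
  have X0 : 'X != 0 :> {poly R} by rewrite polyX_eq0.
  have stau i : (size (tau i) <= 2)%N by rewrite /tau -scaleN1r size_linear.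
  rewrite -(map_polyX (real_complex R)).
  apply: (leading_coef_of_spec gw X0 _ a0 FD (expf_neq0 m n1) (k := m)).
    move=> i j ij; have -> : tau i - tau j = (al i - al j)%:P.
      by rewrite /tau polyCD polyCB; ring.
    (* The only singularity is at [0], with residue [al i - al j]. *)
    rewrite (_ : 'X = ('X - 0%:P) * 1); last by rewrite subr0 mulr1.
    apply: wronskian_rigid_root => k l; rewrite !hornerC mul1r.
    exact/eqP/not_int_sub_nat/ali.
  move=> i e ae; have [up pe _ _] := gw i.
  apply: (symbol_spec_linear up pe _ (stau i) X0 ae n1).
  + by rewrite size_polyX.
  + by rewrite coefX.
  + by rewrite /tau coefB coefC coefX sub0r.
- move=> R N _ a a0 al be al1 be1 abi _ m F _ FD.
  pose rho : {poly R} := 1 - 'X ^+ 2.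
  pose tau i : {poly R} := (be i - al i)%:P - (al i + be i + 2) *: 'X.
  have gw i : good_weight (@dom_jacobi R) (w_jacobi (al i) (be i)) rho (tau i) :=
    jacobi_good_weight (al1 i) (be1 i).
  have n1 : (-1 : R) != 0 by rewrite oppr_eq0 oner_eq0.
  have rho2 : rho`_2 = -1 by rewrite /rho coefB coef1 coefXn sub0r.
  have rho0 : rho != 0 by apply: contraNneq n1 => r0; rewrite -rho2 r0 coef0.
  have srho : (size rho <= 3)%N.
    by rewrite /rho (leq_trans (size_polyD _ _)) // geq_max size_poly1 size_polyN size_polyXn.
  have stau i : (size (tau i) <= 2)%N by rewrite /tau -scaleNr size_linear.
  have -> : 1 - 'X ^+ 2 = map_poly (real_complex R) rho.
    by rewrite /rho rmorphB rmorph1 rmorphXn /= map_polyX.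
  apply: (leading_coef_of_spec gw rho0 _ a0 FD (expf_neq0 m n1) (k := 2 * m)).
    (* The residue of [(tau i - tau j) / rho] is [al i - al j] at [1] and [be i - be j] at [-1]; one
       non-integer residue is enough. *)
    move=> i j ij; case: (abi i j ij) => ni.
      rewrite (_ : rho = ('X - 1%:P) * (- (1 + 'X))); last by rewrite /rho polyC1; ring.
      apply: wronskian_rigid_root => k l; apply/eqP => E.
      apply: (not_int_sub_nat (k := k) (l := l) ni); move: E; rewrite /tau !hornerE /=; lra.
    rewrite (_ : rho = ('X - (-1)%:P) * (1 - 'X)); last by rewrite /rho polyCN polyC1; ring.
    apply: wronskian_rigid_root => k l; apply/eqP => E.
    apply: (not_int_sub_nat (k := k) (l := l) ni); move: E; rewrite /tau !hornerE /=; lra.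
  move=> i e ae; have [up pe _ _] := gw i.
  by rewrite -rho2; apply: (symbol_spec_quadratic up pe srho (stau i) rho0 ae).
Qed.
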